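(* Let $n\ge 1$. The map $\equiv\ \mapsto\ \theta$, which associates to a regular right congruence $\equiv$ on the free monoid $\{a,b\}^*$ having exactly $n$ classes the permutation $\theta\in S_{n+1}$ constructed in the context, is a bijection from the set of regular right congruences on $\{a,b\}^*$ into $n$ classes onto the set of indecomposable permutations in $S_{n+1}$.
   Context: Permutations. A permutation $\sigma\in S_m$ is indecomposable if $\sigma(\{1,\dots,i\})\neq\{1,\dots,i\}$ for all $i\in\{1,\dots,m-1\}$. Words. $\{a,b\}^*$ is the free monoid on the letters $a,b$, with empty word denoted $1$; $x^*=\{x^i: i\ge 0\}$ for a letter $x$. A word $u$ is a prefix of $w$ if $w=uv$ for some word $v$. A subset $C$ is prefix-free if no element of $C$ is a proper prefix of another element of $C$; it is maximal if not contained in a strictly larger prefix-free set. A subset $P$ is prefix-closed if it contains all prefixes of its elements. To a finite maximal prefix-free set $C$ one associates the finite prefix-closed set $P=\{a,b\}^*\setminus C\{a,b\}^*$ of proper prefixes of words in $C$; one has $|C|=|P|+1$. The alphabetical order $<$ on $\{a,b\}^*$ (with $a<b$) is: $u<v$ iff $u$ is a proper prefix of $v$, or $u=xay$, $v=xbz$ for some words $x,y,z$. Right congruences. A right congruence on $\{a,b\}^*$ is an equivalence relation $\equiv$ such that $u\equiv v$ implies $uw\equiv vw$. It is regular if right multiplication by each word (equivalently by each of $a$, $b$) induces a bijection on the set of classes. It is a known fact that right congruences of finite index $n$ on $\{a,b\}^*$ are in bijection with triplets $(C,P,f)$, where $C$ is a finite maximal prefix-free set with $n+1$ elements, $P$ is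 its associated prefix-closed set (with $n$ elements), and $f:C\to P$ is a function with $f(c)<c$ for all $c\in C$; the congruence corresponding to $(C,P,f)$ is generated by the relations $c\equiv f(c)$, $c\in C$, and $P$ is a set of representatives of the classes. Twisted alphabetical order. Define the equivalence relation $u\sim v$ iff $ua^*\cap va^*\neq\emptyset$ on $\{a,b\}^*$; its classes are the sets $wa^*$ with $w=1$ or $w$ ending with $b$. The twisted alphabetical order $\prec$ is the total order given by: $u\prec v$ iff either $u\sim v$ and $v<u$, or $u\not\sim v$ and $u<v$. It is extended to $\{a,b\}^*\cup\{a^{-1}\}$ (with $a^{-1}$ an additional symbol) by $a^i\prec a^{-1}\prec w$ for every $i\ge 0$ and every word $w\in\{a,b\}^*$ containing at least one letter $b$. Construction of $\theta$. Let $\equiv$ be a regular right congruence with $n$ classes and let $(C,P,f)$ be the corresponding triplet. Put $\tilde P=P\cup\{a^{-1}\}$ and let $a^k$ be the unique element of $C\cap a^*$. Let $\phi:C\to\tilde P$ coincide with $f$ except that $\phi(a^k)=a^{-1}$; for a regular right congruence, $\phi$ is a bijection. Write $C=\{c_1<c_2<\dots<c_{n+1}\}$ (alphabetical order) and $\tilde P=\{p_1\prec p_2\prec\dots\prec p_{n+1}\}$ (extended twisted order). Then $\theta\in S_{n+1}$ is the permutation defined by $\theta(i)=j$ iff $\phi(c_i)=p_j$. *)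

(* Defs.v *)
From HB Require Import structures.
From Corelib Require Import RelationClasses.
From mathcomp Require Import all_boot all_order all_fingroup.
From mathcomp Require Import finmap.
From mathcomp Require Import all_classical.

Set Implicit Arguments.
Unset Strict Implicit.
Unset Printing Implicit Defensive.

Import Order.TTheory.

Local Open Scope classical_set_scope.

(* The letters are the booleans: a is [false], b is [true]. *)
Definition word := seq bool.
Notation la := false (only parsing).
Notation lb := true (only parsing).

Definition proper_prefix (u v : word) : bool := prefix u v && (u != v).

(* w \in a^* *)
Definition apower (w : word) : bool := w == nseq (size w) la.

Definition alpha_lt (u v : word) : bool := ((u : seqlexi bool) < v)%O.

Lemma alpha_ltP (u v : word) :
  reflect (proper_prefix u v \/
           exists x y z : word, u = x ++ la :: y /\ v = x ++ lb :: z)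
          (alpha_lt u v).
Proof.
rewrite /alpha_lt; apply: (iffP idP).
- elim: u v => [|x u IH] [|y v] //=.
    by move=> _; left.
  rewrite Order.SeqLexiOrder.ltxi_cons.
  case: x; case: y => //= uv.
  + have [/andP[p n]|[s [t [r [-> ->]]]]] := IH _ uv.
      by left; rewrite /proper_prefix /= p.
    by right; exists (true :: s), t, r.
  + by right; exists [::], u, v.
  + have [/andP[p n]|[s [t [r [-> ->]]]]] := IH _ uv.
      by left; rewrite /proper_prefix /= p.
    by right; exists (false :: s), t, r.
- case.
    case/andP=> /prefixP[t ->].
    elim: u => [|x u IH] /=; first by case: t.
    by rewrite eqseq_cons eqxx /= => /IH; rewrite Order.SeqLexiOrder.ltxi_cons lexx.
  move=> [x [y [z [-> ->]]]].
  elim: x => [|c x IH] //=.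
  by rewrite Order.SeqLexiOrder.ltxi_cons lexx.
Qed.

Definition prefix_free (C : set word) : Prop :=
  forall u v, C u -> C v -> ~~ proper_prefix u v.

Definition maximal_prefix_free (C : set word) : Prop :=
  prefix_free C /\ forall D : set word, prefix_free D -> ~ C `<` D.

(* C{a,b}^* *)
Definition right_ideal (C : set word) : set word :=
  [set u ++ v | u in C & v in [set: word]].

Definition right_congruence (E : word -> word -> Prop) : Prop :=
  Equivalence E /\ forall u v w : word, E u v -> E (u ++ w) (v ++ w).

Definition generated_congruence (R : word -> word -> Prop) (u v : word) : Prop :=
  forall E : word -> word -> Prop,
    right_congruence E -> (forall x y, R x y -> E x y) -> E u v.

(* The class of u is the set [E u]. *)
Definition classes (E : word -> word -> Prop) : set (set word) :=
  [set E u | u in [set: word]].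

(* For a right congruence, this sends the class of u to the class of u ++ w. *)
Definition class_mul (E : word -> word -> Prop) (w : word) (K : set word) :
    set word :=
  [set v | exists2 u, K u & E (u ++ w) v].

Definition regular (E : word -> word -> Prop) : Prop :=
  forall w : word, set_bij (classes E) (classes E) (class_mul E w).

Definition regular_right_congruences (n : nat) : set (word -> word -> Prop) :=
  [set E | [/\ right_congruence E, regular E & (classes E #= `I_n)%card]].

Record triplet := Triplet {
  tC : {fset word};
  tP : {fset word};
  tf : tC -> tP
}.

Definition valid_triplet (n : nat) (T : triplet) : Prop :=
  [/\ maximal_prefix_free [set` tC T],
      #|` tC T| = n.+1,
      [set` tP T] = ~` right_ideal [set` tC T]
    & forall c : tC T, alpha_lt (val (tf c)) (val c)].

Definition triplet_congruence (T : triplet) : word -> word -> Prop :=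
  generated_congruence
    (fun u v => exists c : tC T, u = val c /\ v = val (tf c)).

Definition a_coset (w : word) : set word :=
  [set w ++ nseq i la | i in [set: nat]].

Definition a_sim (u v : word) : Prop := (a_coset u `&` a_coset v) !=set0.

Definition twisted_lt (u v : word) : Prop :=
  (a_sim u v /\ alpha_lt v u) \/ (~ a_sim u v /\ alpha_lt u v).

(* [None] stands for the additional symbol a^{-1}. *)
Definition xtwisted_lt (p q : option word) : Prop :=
  match p, q with
  | Some u, Some v => twisted_lt u v
  | Some u, None => apower u
  | None, Some v => lb \in v
  | None, None => False
  end.

Definition tildeP (T : triplet) : set (option word) :=
  [set Some p | p in [set` tP T]] `|` [set None].

Definition phi (T : triplet) (c : tC T) : option word :=
  if apower (val c) then None else Some (val (tf c)).

Definition increasing_enumeration (V : Type) (m : nat) (lt : V -> V -> Prop)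
    (A : set V) (s : 'I_m -> V) : Prop :=
  (forall i j : 'I_m, i < j -> lt (s i) (s j)) /\ range s = A.

(* With indices starting from 0: theta(i) = j iff phi(c_i) = p_j. *)
Definition triplet_perm (n : nat) (T : triplet) (theta : 'S_n.+1) : Prop :=
  exists (c : 'I_n.+1 -> tC T) (p : 'I_n.+1 -> option word),
    [/\ increasing_enumeration (fun x y : tC T => alpha_lt (val x) (val y))
          [set: tC T] c,
        increasing_enumeration xtwisted_lt (tildeP T) p
      & forall i j : 'I_n.+1, theta i = j <-> phi (c i) = p j].

Definition congruence_perm (n : nat) (E : word -> word -> Prop)
    (theta : 'S_n.+1) : Prop :=
  exists T : triplet,
    [/\ valid_triplet n T, E = triplet_congruence T & triplet_perm T theta].

(* On ordinals, {1, ..., i} becomes {j | j < i}. *)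
Definition indecomposable (m : nat) (s : 'S_m) : Prop :=
  forall i : nat, 0 < i < m ->
    s @: [set j : 'I_m | j < i]%SET <> [set j : 'I_m | j < i]%SET.

(* Main.v *)
Require Import Defs.
From mathcomp Require Import all_boot all_order all_fingroup.
From mathcomp Require Import finmap.
From mathcomp Require Import all_classical.

(**
The set P is the depth-first search tree of the automaton of the congruence
(letter a before b), and C is the set of edges outside this tree, so every
right congruence of finite index has exactly one triplet.  Write
c_0 < ... < c_n for the elements of C and J_i for the number of elements of P
that are smaller than c_i.

A triplet defines a regular congruence iff phi is injective and
f(w a^{j+1}) = w for every w a^{j+1} in C where w is empty or ends with b: the
relation f(c) < c makes the a-cycles of a regular automaton exactly the chains
w, wa, ..., wa^j.  In the twisted order, a^{-1} and the elements of P smaller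
than c_i form an initial segment of J_i + 1 elements; it contains phi(c_l) for
l <= i, and its last element is phi(c_l) for some l <= i.  So, counting from 0,
J_i is the maximum of theta(0), ..., theta(i).

The smallest word at which two trees differ shows that P is determined by the
numbers J_i, so theta determines the triplet.  The elements of P smaller than
c_i form a tree with J_i + 1 leaves, among which are c_0, ..., c_i and, for
i < n, one more; so J_i > i, which means that theta is indecomposable.
Conversely, if the prefix maxima J_i of theta satisfy J_i > i for i < n, a tree
with these numbers is obtained by going through the words in alphabetical
order, and theta then prescribes phi.
*)

Set Implicit Arguments.
Unset Strict Implicit.
Unset Printing Implicit Defensive.

Import Order.TTheory.

Local Open Scope classical_set_scope.

(** * Alphabetical and twisted orders *)

(** A mere cast: it exposes the lexicographic order instance, so that words can serve as keys for
    [rank]. *)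
Definition lexw (w : word) : seqlexi bool := w.

Lemma alpha_nil (w : word) : alpha_lt [::] w = (w != [::]).
Proof. by case: w. Qed.

Lemma alpha_nilr (u : word) : alpha_lt u [::] = false.
Proof. by case: u. Qed.

Lemma alpha_cat2l (u v w : word) : alpha_lt (w ++ u) (w ++ v) = alpha_lt u v.
Proof.
elim: w => //= x w <-.
by rewrite /alpha_lt Order.SeqLexiOrder.ltxi_cons lexx.
Qed.

Lemma alpha_irr (u : word) : alpha_lt u u = false.
Proof. exact: ltxx. Qed.

Lemma alpha_trans : transitive alpha_lt.
Proof. by move=> v u w; exact: (@lt_trans _ (seqlexi bool)). Qed.

Lemma alpha_total (u v : word) : [|| u == v, alpha_lt u v | alpha_lt v u].
Proof. by rewrite /alpha_lt; have := @ltgtP _ (seqlexi bool) u v; case=> // ->;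
  rewrite eqxx. Qed.

Lemma alpha_nlt (u v : word) : ~~ alpha_lt u v -> u != v -> alpha_lt v u.
Proof. by move=> /negbTE h /negbTE h'; have := alpha_total u v;
  rewrite h h'. Qed.

Lemma alpha_asym (u v : word) : alpha_lt u v -> alpha_lt v u = false.
Proof. by move=> h; apply/negP => /(alpha_trans h); rewrite alpha_irr. Qed.

Lemma prefix_alpha (u v : word) : prefix u v -> u != v -> alpha_lt u v.
Proof. by move=> p n; apply/alpha_ltP; left; rewrite /proper_prefix p. Qed.

(** Nothing lies strictly between [q] and [rcons q false]: appending a letter a gives the immediate
    successor. *)
Lemma alpha_rcons (q c : word) :
  alpha_lt q c -> (c == rcons q false) || alpha_lt (rcons q false) c.
Proof.
elim: q c => [|x q IH] [|y c] //=; last first.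
  rewrite eqseq_cons /alpha_lt !Order.SeqLexiOrder.ltxi_cons.
  by case: x; case: y => //=; apply: IH.
move=> _; rewrite eqseq_cons; case: y => //=.
rewrite -(cat1s _ [::]) -(cat1s false c) (alpha_cat2l [::] c [:: false])
  alpha_nil.
by case: c.
Qed.

Lemma cat_nseqS (T : Type) (w : seq T) (m : nat) (x : T) :
  w ++ nseq m.+1 x = rcons (w ++ nseq m x) x.
Proof. by rewrite -addn1 nseqD catA cats1. Qed.

(** Deleting the trailing letters a gives the shortest word of the class of [w] under [a_sim]; it is
    empty or ends with b. *)
Fixpoint strip (w : word) : word :=
  if w is x :: w' then
    let s := strip w' in if ~~ x && (s == [::]) then [::] else x :: s
  else [::].

Lemma strip_rcons (w : word) (x : bool) :
  strip (rcons w x) = if x then rcons w x else strip w.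
Proof.
elim: w => [|y w IH] /=; first by case: x.
by case: x IH => ->; case: y; case: w.
Qed.

Lemma strip_cat (w : word) (m : nat) : strip (w ++ nseq m false) = strip w.
Proof.
elim: m w => [|m IH] w; first by rewrite cats0.
by rewrite [nseq _ _]/= -cat_rcons IH strip_rcons.
Qed.

Lemma strip_decomp (w : word) :
  w = strip w ++ nseq (size w - size (strip w)) false.
Proof.
elim/last_ind: w => [//|w x IH]; rewrite strip_rcons; case: x.
  by rewrite subnn cats0.
have h : size (strip w) <= size w by rewrite {2}IH size_cat leq_addr.
by rewrite size_rcons subSn // cat_nseqS -IH.
Qed.

Lemma stripK (w : word) : strip (strip w) = strip w.
Proof. by rewrite {2}[w]strip_decomp strip_cat. Qed.

Lemma apowerE (w : word) : apower w = (strip w == [::]).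
Proof.
apply/eqP/eqP => [->|h]; first by rewrite -[nseq _ _]cat0s strip_cat.
by rewrite [LHS]strip_decomp h /= subn0.
Qed.

Lemma strip_nil (w : word) : (strip w != [::]) = (true \in w).
Proof.
elim/last_ind: w => // w x IH; rewrite strip_rcons mem_rcons in_cons.
by case: x => //; case: w {IH}.
Qed.

Lemma prefix_strip (w : word) : prefix (strip w) w.
Proof. by rewrite {2}[w]strip_decomp prefix_prefix. Qed.

Lemma a_simE (u v : word) : a_sim u v <-> strip u = strip v.
Proof.
split=> [[w [[i _ <-] [j _ e]]]|e].
  by rewrite -(strip_cat u i) -e strip_cat.
exists (strip u ++ nseq (size u + size v) false); split.
- exists (size v + size (strip u)) => //.
  rewrite {1}[u]strip_decomp -catA -nseqD; congr (_ ++ nseq _ _).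
  by rewrite addnCA subnK ?size_prefix ?prefix_strip // addnC.
- exists (size u + size (strip u)) => //.
  rewrite {1}[v]strip_decomp -e -catA -nseqD; congr (_ ++ nseq _ _).
  by rewrite addnCA subnK ?[size v + _]addnC // e size_prefix ?prefix_strip.
Qed.

(* In its class, a^{-1} behaves as a word of size -1, whence the shift by one. *)
Definition twisted_key (q : option word) : (seqlexi bool *l nat^d)%type :=
  if q is Some u then (lexw (strip u), (size u).+1)
  else (lexw [::], 0).

Lemma twisted_key_inj : injective twisted_key.
Proof.
move=> [u|] [v|] //= [e s]; congr Some.
by rewrite [u]strip_decomp [v]strip_decomp (e : strip u = strip v) s.
Qed.

Lemma twisted_key_ltE (p q : option word) :
  (twisted_key p < twisted_key q)%O =
  alpha_lt (twisted_key p).1 (twisted_key q).1 ||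
  ((twisted_key p).1 == (twisted_key q).1 :> word) &&
  ((twisted_key q).2 < (twisted_key p).2)%N.
Proof.
rewrite Order.ProdLexiOrder.ltEprodlexi /alpha_lt.
by case: (ltgtP (twisted_key p).1 (twisted_key q).1) => _ //=.
Qed.

(** Append the trailing letters a one at a time: each step moves to the immediate successor, so [c]
    can be passed only by landing on it, and then [c] is a prefix of [u]. *)
Lemma alpha_strip (u c : word) :
  alpha_lt (strip u) c -> ~~ prefix c u -> alpha_lt u c.
Proof.
rewrite {2 3}[u]strip_decomp.
elim: (_ - _) => [|m IH]; first by rewrite cats0.
rewrite cat_nseqS => h np.
have /IH {}IH : alpha_lt (strip u) c by [].
have /IH/alpha_rcons/orP[/eqP e|//] : ~~ prefix c (strip u ++ nseq m false).
  by apply: contra np => /prefix_trans -> //; rewrite prefix_rcons.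
by rewrite e prefix_refl in np.
Qed.

Lemma prefix_strip_id (s u : word) :
  strip s = s -> prefix s u -> prefix s (strip u).
Proof.
move=> es; elim/last_ind: u => [|u x IH] // /prefixP[t].
case/lastP: t => [|t y] /=; first by rewrite cats0 => ->;
  rewrite es prefix_refl.
rewrite -rcons_cat => /rcons_inj[e ->].
rewrite strip_rcons; case: y; last by apply: IH; rewrite e prefix_prefix.
by rewrite e rcons_cat prefix_prefix.
Qed.

(** This makes the twisted order lexicographic on pairs: the class first, then the length reversed.
    Only one implication needs work; the other follows by totality. *)
Lemma alpha_strip2 (u v : word) : strip u != strip v ->
  alpha_lt u v = alpha_lt (strip u) (strip v).
Proof.
suff H u' v' : alpha_lt (strip u') (strip v') -> alpha_lt u' v'.
  move=> n; apply/idP/idP => [h|/H//]; apply: contraTT h => h.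
  by have /H/alpha_asym -> := alpha_nlt h n.
move=> h; have nn : ~~ prefix (strip v') (strip u').
  apply/negP => p; have := prefix_alpha p.
  rewrite alpha_asym //; case: eqVneq => // [e|_ /(_ isT)//].
  by rewrite e alpha_irr in h.
have {}nn : ~~ prefix (strip v') u'.
  by apply: contra nn; apply: prefix_strip_id; rewrite stripK.
have := alpha_strip h nn.
have := prefix_alpha (prefix_strip v');
  case: eqVneq => [-> //|_ /(_ isT) h1 h2].
exact: alpha_trans h2 h1.
Qed.

Lemma alpha_nseq (i j : nat) :
  alpha_lt (nseq i false) (nseq j false) = (i < j).
Proof.
elim: i j => [|i IH] [|j] //=.
by rewrite -(cat1s false) -(cat1s _ (nseq j _)) alpha_cat2l IH.
Qed.

Lemma xtwisted_ltE (p q : option word) :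
  xtwisted_lt p q <-> (twisted_key p < twisted_key q)%O.
Proof.
rewrite twisted_key_ltE; case: p => [u|]; case: q => [v|] /=; last by [].
- rewrite ltnS /lexw /twisted_lt !a_simE.
  case: (eqVneq (strip u) (strip v)) => [e|n]; last first.
    rewrite /= orbF -alpha_strip2 //; split=> [[[e _]|[]//]|]; last by right;
      split=> // /eqP; rewrite (negbTE n).
    by rewrite e eqxx in n.
  have -> : alpha_lt v u = (size v < size u).
    rewrite {1}[u]strip_decomp {1}[v]strip_decomp e alpha_cat2l alpha_nseq.
    by rewrite ltn_sub2rE ?size_prefix ?prefix_strip.
  by rewrite e alpha_irr; split=> [[[]|[]]|]//; left.
- by rewrite apowerE andbT /lexw; case: (strip u) => //=; rewrite orbT.
- by rewrite -strip_nil alpha_nil andbF orbF.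
Qed.

(** * Ranks and increasing enumerations *)

Lemma mem_sep (V : choiceType) (A : {fset V}) (p : pred V) (x : V) :
  (x \in [fset y in A | p y]%fset) = (x \in A) && p x.
Proof. by rewrite !inE. Qed.

(** [x] need not belong to [A]: ranking a leaf among the nodes gives the number J_i. *)
Definition rank (d : Order.disp_t) (V : choiceType) (T : orderType d)
  (K : V -> T) (A : {fset V}) (x : V) : nat :=
  #|` [fset y in A | (K y < K x)%O]%fset|.

Lemma rank_le (d : Order.disp_t) (V : choiceType) (T : orderType d)
    (K : V -> T) (A : {fset V}) (x y : V) :
  (K x <= K y)%O -> rank K A x <= rank K A y.
Proof.
move=> le; apply: fsubset_leq_card; apply/fsubsetP => z.
by rewrite !inE /= => /andP[-> /lt_le_trans ->].
Qed.

Lemma fset_ltn_card (V : choiceType) (A B : {fset V}) (x : V) :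
  {subset A <= B} -> x \in B -> x \notin A -> #|` A| < #|` B|.
Proof.
move=> AB xB xA; apply/fproper_ltn_card; rewrite fproperE.
apply/andP; split; first exact/fsubsetP.
by apply/fsubsetPn; exists x.
Qed.

Lemma rank_lt (d : Order.disp_t) (V : choiceType) (T : orderType d)
    (K : V -> T) (A : {fset V}) (x y : V) :
  x \in A -> (K x < K y)%O -> rank K A x < rank K A y.
Proof.
move=> xA lt; apply: (fset_ltn_card (x := x)); rewrite ?inE /= ?xA ?lt ?ltxx //.
by move=> z; rewrite !inE /= => /andP[-> /lt_trans ->].
Qed.

Lemma rank_ltE (d : Order.disp_t) (V : choiceType) (T : orderType d)
    (K : V -> T) (A : {fset V}) (x y : V) :
  x \in A -> (rank K A x < rank K A y) = (K x < K y)%O.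
Proof.
move=> xA; case: ltP => [/rank_lt->//|/(rank_le A)]; by rewrite ltnNge => ->.
Qed.

Lemma rank_card (d : Order.disp_t) (V : choiceType) (T : orderType d)
    (K : V -> T) (A : {fset V}) (x : V) :
  x \in A -> rank K A x < #|` A|.
Proof.
move=> xA; apply: (fset_ltn_card (x := x)); rewrite ?inE /= ?ltxx ?andbF //.
by move=> z; rewrite !inE /= => /andP[].
Qed.

Lemma rank_inj (d : Order.disp_t) (V : choiceType) (T : orderType d)
    (K : V -> T) (A : {fset V}) : injective K -> {in A &, injective (rank K A)}.
Proof.
move=> Ki x y xA yA e; apply: Ki; apply/eqP; rewrite eq_le !leNgt.
by rewrite -!(@rank_ltE _ _ _ K A) // e ltnn.
Qed.

(** Pigeonhole: the ranks of the elements of [A] are distinct and smaller than its size, so they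
    fill the interval. *)
Lemma rank_surj (d : Order.disp_t) (V : choiceType) (T : orderType d)
    (K : V -> T) (A : {fset V}) (i : nat) :
  injective K -> i < #|` A| -> exists2 x, x \in A & rank K A x = i.
Proof.
move=> Ki iA; pose s := [seq rank K A x | x <- enum_fset A].
have us : uniq s by rewrite map_inj_in_uniq //; exact: rank_inj.
have sub : {subset s <= iota 0 #|` A|}.
  by move=> _ /mapP[x xA ->]; rewrite mem_iota /= add0n rank_card.
have [|_ ss] := uniq_min_size us sub; first by rewrite size_iota size_map.
have : i \in s by rewrite ss mem_iota.
by case/mapP=> x xA ->; exists x.
Qed.

Lemma enumeration_exists (d : Order.disp_t) (V : choiceType) (T : orderType d)
    (K : V -> T) (A : {fset V}) (m : nat) : injective K -> #|` A| = m ->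
  exists s : 'I_m -> V,
    increasing_enumeration (fun x y => (K x < K y)%O) [set` A] s.
Proof.
move=> Ki cA.
have /choice[s sP] : forall i : 'I_m, exists x, x \in A /\ rank K A x = i.
  by move=> i; have [|x] := @rank_surj _ _ _ K A i Ki; [rewrite cA|exists x].
exists s; split => [i j lt|].
  by have [si ei] := sP i; have [sj ej] := sP j;
    rewrite -(rank_ltE _ _ si) ei ej.
rewrite eqEsubset; split => [_ [i _ <-]|x xA]; first by case: (sP i).
have h : rank K A x < m by rewrite -cA rank_card.
exists (Ordinal h) => //; have [si ei] := sP (Ordinal h).
exact: (rank_inj Ki si xA ei).
Qed.

Lemma enumeration_rank (d : Order.disp_t) (V : choiceType) (T : orderType d)
    (K : V -> T) (A : {fset V}) (m : nat) (s : 'I_m -> V) (i : 'I_m) :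
    increasing_enumeration (fun x y => (K x < K y)%O) [set` A] s ->
  rank K A (s i) = i.
Proof.
move=> [inc ran].
have si : injective s.
  move=> j k e; apply: val_inj => /=.
  by have [/inc/=|/inc/=|//] := ltngtP j k; rewrite e ltxx.
have -> : rank K A (s i) = #|` [fset s j | j in [pred j : 'I_m | j < i]]%fset|.
  congr #|` _|; apply/fsetP => x; rewrite !inE /=; apply/andP/imfsetP => /=.
    move=> [xA lt]; have : range s x by rewrite ran.
    case=> j _ e; exists j => //; rewrite -e in lt.
    have [//|/inc/=/(lt_trans lt)|/val_inj e'] := ltngtP j i;
      first by rewrite ltxx.
    by rewrite e' ltxx in lt.
  move=> [j /= lt ->]; rewrite inc //; split=> //.
  by have : [set` A] (s j) by rewrite -ran; exists j.
rewrite card_imfset /=; last exact: si.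
rewrite -cardE -[RHS]card_ord.
have wi : injective (widen_ord (ltnW (ltn_ord i))).
  by move=> j k /(congr1 val) /= e; apply: val_inj.
rewrite -(fintype.card_image wi).
apply: eq_card => j; apply/idP/fintype.imageP => [h|[k _ ->]//=].
  by exists (Ordinal h) => //; apply: val_inj.
exact: (ltn_ord k).
Qed.

(** * Prefix-closed sets and their leaves *)

(** The empty word is its own parent, so the closure condition in [tree] needs no exception for the
    root. *)
Definition par (w : word) : word := take (size w).-1 w.

Lemma par_rcons (w : word) (x : bool) : par (rcons w x) = w.
Proof. by rewrite /par size_rcons -cats1 take_size_cat. Qed.

Lemma par_prefix (w : word) : prefix (par w) w.
Proof. exact: prefix_take. Qed.

Lemma par_lt (w : word) : w != [::] -> alpha_lt (par w) w.
Proof.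
move=> n; apply: prefix_alpha; first exact: par_prefix.
by case/lastP: w n => // w x _;
  rewrite par_rcons -{1}[w]cats0 -cats1 eqseq_cat // eqxx.
Qed.

Definition tree (P : {fset word}) : Prop :=
  [::] \in P /\ forall w, w \in P -> par w \in P.

(** For a tree [P] these are the minimal words outside [P] in the prefix order, that is, the set C
    associated with [P]. *)
Definition leaves (P : {fset word}) : {fset word} :=
  (([fset rcons p false | p in P] `|` [fset rcons p true | p in P]) `\` P)%fset.

Lemma mem_children (P : {fset word}) (w : word) :
  (w \in [fset rcons p false | p in P] `|` [fset rcons p true | p in P])%fset
  = (w != [::]) && (par w \in P).
Proof.
rewrite !inE; case/lastP: w => [|w x].
  by apply/negbTE; rewrite negb_or; apply/andP; split; apply/imfsetP => -[[]].
rewrite par_rcons; have -> /= : rcons w x != [::] by case: w.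
apply/orP/idP => [[]/imfsetP[p /= pP /rcons_inj[->]]//|wP].
by case: x; [right|left]; apply/imfsetP; exists w.
Qed.

Lemma mem_leaves (P : {fset word}) (w : word) : tree P ->
  (w \in leaves P) = (w \notin P) && (par w \in P).
Proof.
move=> [P0 _]; rewrite in_fsetD mem_children.
by case: eqVneq => [->|//]; rewrite P0.
Qed.

(** The nodes have 2|P| children in all: the leaves and the |P| - 1 nonempty nodes. *)
Lemma card_leaves (P : {fset word}) : tree P -> #|` leaves P| = #|` P|.+1.
Proof.
move=> [P0 Pp]; rewrite /leaves.
set F := [fset rcons p false | p in P]%fset;
  set T := [fset rcons p true | p in P]%fset.
have e : (F `&` T = fset0)%fset.
  apply/fsetP => w; rewrite !inE; apply/negP => /andP[/imfsetP[p _ ->]].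
  by case/imfsetP => q _ /rcons_inj[].
have cF : #|` F| = #|` P| by rewrite card_imfset // => u v /rcons_inj[].
have cT : #|` T| = #|` P| by rewrite card_imfset // => u v /rcons_inj[].
have := cardfsUI F T; rewrite e cardfs0 addn0 cF cT.
have := cardfsID P (F `|` T)%fset.
have -> : ((F `|` T) `&` P = P `\ [::])%fset.
  apply/fsetP => w; rewrite in_fsetI in_fsetD1 mem_children.
  by case wP: (w \in P); rewrite ?andbF // Pp ?andbT.
have := cardfsD1 [::] P; rewrite P0 => e1 e2 e3.
by apply: (@addnI #|` P `\ [::]|%fset); rewrite e2 e3 {1}e1 add1n addSn addnS.
Qed.

Lemma tree_prefix (P : {fset word}) (u v : word) :
  tree P -> prefix u v -> v \in P -> u \in P.
Proof.
move=> [_ Pp] /prefixP[t ->]; elim/last_ind: t => [|t x IH];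
  first by rewrite cats0.
by rewrite -rcons_cat => /Pp; rewrite par_rcons.
Qed.

Lemma leaf_notin (P : {fset word}) (c : word) : c \in leaves P -> c \notin P.
Proof. by rewrite in_fsetD => /andP[]. Qed.

Lemma leaf_par (P : {fset word}) (c : word) :
  tree P -> c \in leaves P -> par c \in P.
Proof. by move=> tP; rewrite mem_leaves // => /andP[]. Qed.

Lemma leaf_below (P : {fset word}) (w : word) : tree P ->
  w \notin P -> exists2 c, c \in leaves P & prefix c w.
Proof.
move=> tP; elim/last_ind: w => [|w x IH wP]; first by rewrite tP.1.
case wP': (w \in P).
  by exists (rcons w x); rewrite ?prefix_refl // mem_leaves // wP par_rcons.
have [c cP cw] := IH (negbT wP'); exists c => //.
by rewrite (prefix_trans cw) // prefix_rcons.
Qed.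

Lemma leaf_prefix (P : {fset word}) (c w : word) : tree P ->
  c \in leaves P -> prefix c w -> w \notin P.
Proof. by move=> tP /leaf_notin + cw; apply: contra; apply: tree_prefix. Qed.

Lemma leaf_prefix_eq (P : {fset word}) (c c' : word) : tree P ->
  c \in leaves P -> c' \in leaves P -> prefix c c' -> c = c'.
Proof.
move=> tP cP cP' /prefixP[t e]; case/lastP: t e => [|t x e];
  first by rewrite cats0.
have := leaf_par tP cP'; rewrite e -rcons_cat par_rcons.
by rewrite (negbTE (leaf_prefix tP cP (prefix_prefix _ _))).
Qed.

(** A finite set cannot contain all the words w, wa, waa, ...; the first one outside [P] is a
    leaf. *)
Lemma leaf_ray (P : {fset word}) (w : word) : tree P -> w \in P ->
  exists j, w ++ nseq j.+1 false \in leaves P.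
Proof.
move=> tP wP.
have ex : exists i, w ++ nseq i false \notin P.
  apply: contrapT => no; have h i : w ++ nseq i false \in P.
    by apply/negPn/negP => hi; apply: no; exists i.
  pose s := [seq w ++ nseq i false | i <- iota 0 #|` P|.+1].
  have us : uniq s.
    rewrite map_inj_uniq ?iota_uniq // => i j /eqP;
      rewrite eqseq_cat // eqxx /=.
    by move=> /eqP/(congr1 size); rewrite !size_nseq.
  have /(uniq_leq_size us) : {subset s <= enum_fset P} by move=> _ /mapP[i _
    ->].
  by rewrite size_map size_iota ltnn.
case: (ex_minnP ex) => -[|i]; first by rewrite cats0 wP.
move=> iP imin; exists i; rewrite mem_leaves // iP cat_nseqS par_rcons.
by apply/negPn/negP => /imin; rewrite ltnn.
Qed.

(** * Ranks in a tree *)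

Lemma lexw_inj : injective lexw.
Proof. by []. Qed.

Definition rank_leaf (P : {fset word}) (c : word) : nat :=
  rank lexw (leaves P) c.

Definition rank_node (P : {fset word}) (w : word) : nat := rank lexw P w.

Definition tilde (P : {fset word}) : {fset option word} :=
  (None |` [fset Some p | p in P])%fset.

Definition rank_tilde (P : {fset word}) (q : option word) : nat :=
  rank twisted_key (tilde P) q.

Lemma mem_tilde (P : {fset word}) (q : option word) :
  (q \in tilde P) = if q is Some u then u \in P else true.
Proof.
rewrite in_fset1U; case: q => [u|] //=.
by apply/imfsetP/idP => [[v /= vP [->]]|uP] //; exists u.
Qed.

Lemma card_tilde (P : {fset word}) : #|` tilde P| = #|` P|.+1.
Proof.
rewrite cardfsU1 card_imfset; last by move=> u v [].
by rewrite (_ : None \notin _ = true) //; apply/imfsetP => -[].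
Qed.

Lemma leaf_neq0 (P : {fset word}) (c : word) :
  tree P -> c \in leaves P -> c != [::].
Proof. by move=> [P0 _] /leaf_notin; apply: contraNneq => ->. Qed.

(** A leaf is never a prefix of a node, so appending letters a inside [P] cannot cross [c]. Hence
    each class has either all or none of its nodes below [c]. *)
Lemma alpha_strip_leaf (P : {fset word}) (c u : word) :
  tree P -> c \in leaves P -> u \in P -> alpha_lt (strip u) c = alpha_lt u c.
Proof.
move=> tP cP uP; apply/idP/idP => [h|].
  by apply: alpha_strip h _; apply: contraL uP; apply: leaf_prefix.
have := prefix_alpha (prefix_strip u).
by case: eqVneq => [->//|_ /(_ isT)]; apply: alpha_trans.
Qed.

Lemma leaf_ray_le (P : {fset word}) (c w : word) (j : nat) :
  tree P -> c \in leaves P -> w ++ nseq j false \in leaves P ->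
  alpha_lt (strip w) c ->
  w ++ nseq j false = c \/ alpha_lt (w ++ nseq j false) c.
Proof.
move=> tP cP rP wc; case pc: (prefix c (w ++ nseq j false)).
  by left; rewrite (leaf_prefix_eq tP cP rP).
by right; apply: alpha_strip; rewrite ?strip_cat ?pc.
Qed.

(** Together, a^{-1} and the nodes below [c] form an initial segment of the twisted order with
    [rank_node P c] + 1 elements. *)
Lemma rank_tilde_le (P : {fset word}) (c : word) (q : option word) :
  tree P -> c \in leaves P -> q \in tilde P ->
  (rank_tilde P q <= rank_node P c) = alpha_lt (twisted_key q).1 c.
Proof.
move=> tP cP qP; pose D := [fset q in tilde P | alpha_lt (twisted_key q).1
  c]%fset.
have cD : #|` D| = (rank_node P c).+1.
  have -> : D = (None |` [fset Some u | u in [fset u in P | (lexw u < lexw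
    c)%O]])%fset.
    apply/fsetP => -[u|]; rewrite mem_sep in_fset1U mem_tilde /=;
      last by rewrite alpha_nil (leaf_neq0 tP cP).
    apply/andP/imfsetP => /= [[uP]|[v + [->]]].
      rewrite (alpha_strip_leaf tP cP uP) => h.
      by exists u => //; rewrite mem_sep uP.
    by rewrite mem_sep => /andP[vP h]; rewrite (alpha_strip_leaf tP cP vP).
  rewrite cardfsU1 card_imfset; last by move=> u v [].
  by rewrite (_ : None \notin _ = true) //; apply/imfsetP => -[].
(* [D] is closed downwards because membership is a bound on the first component of the key. *)
have down q1 q2 : q1 \in tilde P -> q2 \in D ->
    (twisted_key q1 <= twisted_key q2)%O -> q1 \in D.
  rewrite !mem_sep => -> /andP[_ h]; rewrite Order.ProdLexiOrder.leEprodlexi.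
  case/andP => h1 _; exact: (le_lt_trans h1 h).
rewrite -ltnS -cD; case h: (alpha_lt _ _); last first.
  apply/negbTE; rewrite -leqNgt; apply: fsubset_leq_card;
    apply/fsubsetP => x xD.
  move: (xD); rewrite !mem_sep => /andP[-> _] /=; rewrite ltNge;
    apply/negP => /(down _ _ qP xD).
  by rewrite mem_sep h andbF.
apply: (fset_ltn_card (x := q)); rewrite ?mem_sep ?ltxx ?andbF ?qP ?h //.
move=> x; rewrite mem_sep => /andP[xP /ltW]; move/(down x q xP).
by apply; rewrite mem_sep qP h.
Qed.

(** The last element of the class of [w] in the twisted order when [w] is stripped: longer words
    come first, and a^{-1} comes after all powers of a. *)
Definition head_node (w : word) : option word :=
  if w == [::] then None else Some w.

Lemma twisted_key_head (q : option word) :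
  (twisted_key q <= twisted_key (head_node (twisted_key q).1))%O.
Proof.
rewrite leNgt twisted_key_ltE /head_node; case: q => [u|] /=; last by [].
rewrite /lexw; case: eqVneq => [->//|n] /=.
by rewrite stripK alpha_irr eqxx ltnS -leqNgt size_prefix ?prefix_strip.
Qed.

Lemma head_node1 (w : word) : strip w = w -> (twisted_key (head_node w)).1 = w.
Proof. by rewrite /head_node; case: eqVneq => [->|]. Qed.

Lemma strip_key (q : option word) : strip (twisted_key q).1 = (twisted_key q).1.
Proof. by case: q => [u|] //=; rewrite stripK. Qed.

Lemma head_tilde (P : {fset word}) (w : word) : w \in P ->
  head_node w \in tilde P.
Proof. by rewrite mem_tilde /head_node; case: eqVneq. Qed.

(** No stripped word lies strictly between w and w a^{j+1}. So the class of w is the last one in the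
    initial segment of this leaf, and the segment ends with the last element of that class. *)
Lemma rank_head_node (P : {fset word}) (w : word) (j : nat) : tree P ->
  w ++ nseq j.+1 false \in leaves P -> strip w = w ->
  rank_tilde P (head_node w) = rank_node P (w ++ nseq j.+1 false).
Proof.
move=> tP cP sw; set c := w ++ _ in cP *.
have wP : w \in P.
  by apply: (tree_prefix tP _ (leaf_par tP cP));
    rewrite /c cat_nseqS par_rcons prefix_prefix.
have hP := head_tilde wP.
have wc : alpha_lt w c.
  by apply: prefix_alpha; [exact: prefix_prefix|apply: contraTneq wP => ->;
    exact: leaf_notin].
have le : rank_tilde P (head_node w) <= rank_node P c.
  by rewrite rank_tilde_le // head_node1.
apply/eqP; rewrite eqn_leq le /= leqNgt; apply/negP => lt.
(* [q] is the last element of the segment; it is shown not to come after [head_node w]. *)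
have [|q qP eq] := @rank_surj _ _ _ twisted_key (tilde P) (rank_node P c)
  twisted_key_inj.
  rewrite card_tilde ltnS; apply: fsubset_leq_card; apply/fsubsetP => x.
  by rewrite mem_sep => /andP[].
have := leqnn (rank_node P c); rewrite -{1}eq rank_tilde_le // => qc.
have : ~~ (twisted_key q <= twisted_key (head_node w))%O.
  by apply: contraL lt => /(rank_le (tilde P)) h; rewrite -leqNgt -eq.
apply/negP/negPn; have [e|n] := eqVneq ((twisted_key q).1 : word) w.
  by rewrite (le_trans (twisted_key_head q)) // e.
apply: ltW; rewrite twisted_key_ltE head_node1 //.
case: (alpha_total (twisted_key q).1 w) => /or3P[/eqP/eqP|->//|h].
  by rewrite (negbTE n).
have : alpha_lt c (twisted_key q).1.
  apply: alpha_strip; first by rewrite strip_cat sw.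
  apply/negP => /(prefix_strip_id (strip_key q));
    rewrite strip_cat sw => /prefix_alpha/(_ n).
  by rewrite (alpha_asym h).
by rewrite (alpha_asym qc).
Qed.

Lemma rank_node_lt_card (P : {fset word}) (c : word) :
  rank_node P c <= #|` P|.
Proof.
by apply: fsubset_leq_card; apply/fsubsetP => x; rewrite mem_sep => /andP[].
Qed.

Lemma nseq_alpha_lt (w : word) (j : nat) : alpha_lt w (w ++ nseq j.+1 false).
Proof. by rewrite -{1}[w]cats0 alpha_cat2l. Qed.

(** The last element of the segment of [c] is the head of a class; the chain of letters a starting
    at [w] leaves the tree at [c] or earlier, by [leaf_ray_le]. *)
Lemma rank_node_attained (P : {fset word}) (c : word) :
  tree P -> c \in leaves P ->
  exists w j, [/\ strip w = w, w ++ nseq j.+1 false \in leaves P,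
    w ++ nseq j.+1 false = c \/ alpha_lt (w ++ nseq j.+1 false) c
    & rank_tilde P (head_node w) = rank_node P c].
Proof.
move=> tP cP.
have [|q qP eq] := @rank_surj _ _ _ twisted_key (tilde P) (rank_node P c)
  twisted_key_inj.
  by rewrite card_tilde ltnS rank_node_lt_card.
have qc : alpha_lt (twisted_key q).1 c by rewrite -(rank_tilde_le tP cP qP) -eq.
set w : word := (twisted_key q).1 in qc.
have sw : strip w = w := strip_key q.
have wP : w \in P.
  rewrite /w; case: (q) qP => [u|_] /=; last exact: tP.1.
  by rewrite mem_tilde; apply: tree_prefix tP (prefix_strip u).
have [j jP] := leaf_ray tP wP; exists w, j; split=> //.
  by apply: (leaf_ray_le tP cP jP); rewrite sw.
apply/eqP; rewrite eqn_leq rank_tilde_le ?head_tilde // head_node1 // qc /=.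
by rewrite -eq; apply: rank_le; apply: twisted_key_head.
Qed.

(** The parent of a leaf ending with a is its immediate predecessor, hence a node above every
    earlier leaf: the numbers J_i jump at such leaves. *)
Lemma rank_node_lt (P : {fset word}) (c c' : word) : tree P ->
  c' \in leaves P -> rcons c false \in leaves P ->
  alpha_lt c' (rcons c false) -> rank_node P c' < rank_node P (rcons c false).
Proof.
move=> tP cP' cP lt; have pP := leaf_par tP cP; rewrite par_rcons in pP.
have pc : alpha_lt c (rcons c false) by rewrite -cats1;
  exact: (nseq_alpha_lt c 0).
have cc : alpha_lt c' c.
  apply: alpha_nlt; last by apply: contraNneq (leaf_notin cP') => <-.
  apply/negP => /alpha_rcons/orP[/eqP e|/(alpha_trans lt)].
    by rewrite e alpha_irr in lt.
  by rewrite alpha_irr.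
by apply: (@leq_ltn_trans (rank_node P c)); [apply/rank_le/ltW|apply: rank_lt].
Qed.

Definition node_below (P : {fset word}) (w : word) : {fset word} :=
  [fset u in P | (lexw u < lexw w)%O]%fset.

Lemma tree_below (P : {fset word}) (w : word) :
  tree P -> w != [::] -> tree (node_below P w).
Proof.
move=> tP; rewrite -alpha_nil => w0; split=> [|u]; rewrite !mem_sep /=.
  by rewrite tP.1.
case/andP => uP uw; rewrite tP.2 //=.
case: (eqVneq u [::]) => [->//|/par_lt h]; exact: alpha_trans h uw.
Qed.

(** Whether [u] is a leaf depends only on [u] and its parent, neither of which exceeds [u]. *)
Lemma rank_leaf_agree (P P' : {fset word}) (w : word) : tree P -> tree P' ->
    (forall u, alpha_lt u w -> (u \in P) = (u \in P')) ->
  rank_leaf P w = rank_leaf P' w.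
Proof.
move=> tP tP' agree.
have agree_par u : alpha_lt u w -> (par u \in P) = (par u \in P').
  move=> uw; apply: agree; case: (eqVneq u [::]) => [e|/par_lt h];
    first by rewrite e in uw *.
  exact: alpha_trans h uw.
congr #|` _|; apply/fsetP => u; rewrite !mem_sep !mem_leaves //.
have [uw|] := boolP (lexw u < lexw w)%O; last by rewrite !andbF.
by rewrite agree // agree_par.
Qed.

(** The nodes below [c] form a tree with [rank_node P c] + 1 leaves. It has among its leaves [c],
    all the leaves before [c], and one more that is a prefix of [c1]. *)
Lemma rank_leaf_lt_node (P : {fset word}) (c c1 : word) : tree P ->
  c \in leaves P -> c1 \in leaves P -> alpha_lt c c1 ->
  rank_leaf P c < rank_node P c.
Proof.
move=> tP cP c1P lt; pose S := node_below P c.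
have tS : tree S := tree_below tP (leaf_neq0 tP cP).
have sub c' : c' \in leaves P -> ~~ alpha_lt c c' -> c' \in leaves S.
  move=> cP' h; rewrite mem_leaves // !mem_sep (negbTE (leaf_notin cP'))
    leaf_par //=.
  have := par_lt (leaf_neq0 tP cP'); case: (eqVneq c c') => [->//|n].
  by move/alpha_trans; apply; rewrite -/(alpha_lt _ _); apply: alpha_nlt.
have c1S : c1 \notin S by rewrite mem_sep (negbTE (leaf_notin c1P)).
have [u uS uc1] := leaf_below tS c1S.
pose L := [fset c' in leaves P | (lexw c' < lexw c)%O]%fset.
have uL : u \notin (c |` L)%fset.
  rewrite in_fset1U mem_sep; apply/negP => h.
  have uP : u \in leaves P by case/orP: h => [/eqP->//|/andP[]].
  have e := leaf_prefix_eq tP uP c1P uc1; rewrite e in h.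
  have lt' := alpha_asym lt.
  case/orP: h => [/eqP e'|/andP[_]]; first by rewrite e' alpha_irr in lt.
  by rewrite -/(alpha_lt _ _) lt'.
have : #|` (u |` (c |` L))%fset| <= #|` leaves S|.
  apply: fsubset_leq_card; apply/fsubsetP => x; rewrite !in_fset1U.
  case/or3P => [/eqP->//|/eqP->|]; first by apply: sub; rewrite ?alpha_irr.
  by rewrite mem_sep => /andP[xP xc]; apply: sub; rewrite // (alpha_asym xc).
rewrite card_leaves // cardfsU1 uL cardfsU1 mem_sep ltxx andbF /= !add1n.
exact.
Qed.

(** Otherwise [w] is a leaf of [P']. The leaf [c] of [P] with the same rank lies above [w], so it
    has more nodes below it, namely at least [w] itself, than [w] has in [P']. *)
Lemma tree_agree (P P' : {fset word}) (w : word) : tree P -> tree P' ->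
    #|` P'| <= #|` P| ->
    (forall c c', c \in leaves P -> c' \in leaves P' ->
       rank_leaf P c = rank_leaf P' c' -> rank_node P c = rank_node P' c') ->
    (forall u, alpha_lt u w -> (u \in P) = (u \in P')) ->
  w \in P -> w \in P'.
Proof.
move=> tP tP' le H agree wP; apply: contraT => wP'.
have w0 : w != [::] by apply: contraNneq wP' => ->; exact: tP'.1.
have wL : w \in leaves P'.
  by rewrite mem_leaves // wP' -agree ?par_lt // tP.2.
have ew : rank_leaf P w = rank_leaf P' w by exact: rank_leaf_agree.
have ew' : rank_node P w = rank_node P' w.
  congr #|` _|; apply/fsetP => u; rewrite !mem_sep.
  by have [uw|] := boolP (lexw u < lexw w)%O; rewrite ?andbF // agree.
have [|c cP ec] := @rank_surj _ _ _ lexw (leaves P) (rank_leaf P' w) lexw_inj.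
  apply: leq_trans (rank_card lexw wL) _.
  by rewrite !card_leaves.
have wc : alpha_lt w c.
  apply: alpha_nlt; last by apply: contraTneq wP => <-; apply: leaf_notin.
  by apply/negP => /(rank_lt cP); rewrite ec -/(rank_leaf _ _) ew ltnn.
by have := @rank_lt _ _ _ lexw P w c wP wc;
  rewrite -!/(rank_node _ _) (H c w cP wL ec) ew' ltnn.
Qed.

(* The condition is only needed at the least element of the symmetric
   difference. *)
Lemma lex_ext (P P' : {fset word}) :
    (forall w, (forall u, alpha_lt u w -> (u \in P) = (u \in P')) ->
       (w \in P) = (w \in P')) ->
  P = P'.
Proof.
move=> H; apply: contrapT => ne.
pose D := ((P `\` P') `|` (P' `\` P))%fset.
have memD w : (w \in D) = ((w \in P) != (w \in P')).
  by rewrite in_fsetU !in_fsetD; case: (w \in P); case: (w \in P').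
have Dn : 0 < #|` D|.
  rewrite cardfs_gt0; apply: contra_notN ne => /eqP e; apply/fsetP => w.
  by apply/eqP; rewrite -[_ == _]negbK -memD e in_fset0.
have [w wD w0] := @rank_surj _ _ _ lexw D 0 lexw_inj Dn.
have := wD; rewrite memD => /eqP; apply; apply: H => u uw.
apply/eqP; rewrite -[_ == _]negbK -memD; apply/negP => uD.
by have := @rank_lt _ _ _ lexw D u w uD uw; rewrite w0.
Qed.

Lemma tree_unique (P P' : {fset word}) : tree P -> tree P' ->
    #|` P| = #|` P'| ->
    (forall c c', c \in leaves P -> c' \in leaves P' ->
       rank_leaf P c = rank_leaf P' c' -> rank_node P c = rank_node P' c') ->
  P = P'.
Proof.
move=> tP tP' cPP' H; apply: lex_ext => w agree; apply/idP/idP.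
  by apply: (tree_agree tP tP' _ H agree); rewrite cPP'.
apply: (@tree_agree P' P) => //; first by rewrite cPP'.
  by move=> c c' cP cP' /esym /(H c' c cP' cP).
by move=> u /agree.
Qed.

(** * Depth-first construction of trees *)

Lemma node_below_nil (P : {fset word}) : node_below P [::] = fset0.
Proof. by apply/fsetP => u; rewrite mem_sep [X in _ && X]alpha_nilr andbF. Qed.

(** Words are decided in increasing order; accepting a larger word later does not alter the set on
    which an earlier decision was based. *)
Lemma sorted_recursion (B : {fset word} -> word ->
  bool) (L : seq (seqlexi bool)) :
  sorted <%O%O L -> exists P : {fset word},
    {subset P <= L} /\ forall w, w \in L -> (w \in P) = B (node_below P w) w.
Proof.
elim/last_ind: L => [_|L w IH sL]; first by exists fset0.
have wmax u : u \in L -> (u < w)%O.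
  move: sL; rewrite -cats1 sorted_pairwise; last exact: lt_trans.
  by rewrite pairwise_cat allrel1r => /andP[/allP h _] /h.
have [|P [PL HP]] := IH; first by move: sL; rewrite -cats1 => /cat_sorted2[].
have Pw : node_below P w = P.
  by apply/fsetP => u; rewrite mem_sep; case uP: (u \in P) => //=;
    apply/wmax/PL.
pose P' := if B P w then (w |` P)%fset else P.
have eqP' u : (u \in P') = (u == w) && B P w || (u \in P).
  by rewrite /P'; case: (B P w); rewrite ?andbT ?andbF ?in_fset1U.
have below u : (u <= w)%O -> node_below P' u = node_below P u.
  move=> uw; apply/fsetP => v; rewrite !mem_sep eqP';
    case: eqVneq => [->|//] /=.
  by rewrite /lexw ltNge uw !andbF.
exists P'; split=> [u|u].
  rewrite eqP' mem_rcons in_cons => /orP[/andP[->]//|/PL ->]; exact: orbT.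
rewrite mem_rcons in_cons eqP'; case: (eqVneq u w) => [->|n] /=.
  rewrite below // Pw; case h: (B P w) => //= _.
  by apply/negbTE/negP => /PL/wmax; rewrite ltxx.
by move=> uL; rewrite HP // below // ltW // wmax.
Qed.

(** The alphabetical order is not well founded on all words, as b > ab > aab > ... shows; bounding
    the length leaves a finite list to go through. *)
Lemma lex_recursion (n : nat) (B : {fset word} -> word -> bool) :
  exists P : {fset word}, (forall w, w \in P -> size w <= n) /\
    forall w, size w <= n -> (w \in P) = B (node_below P w) w.
Proof.
pose L : seq (seqlexi bool) := [seq val t | t : {bseq n of bool}].
have memL w : (w \in sort <=%O%O L) = (size w <= n).
  rewrite mem_sort; apply/mapP/idP => [[t _ ->]|h]; first exact: size_bseq.
  by exists (Bseq h); rewrite ?mem_enum.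
have [|P [PL HP]] := @sorted_recursion B (sort <=%O%O L).
  by rewrite sort_lt_sorted map_inj_uniq ?enum_uniq //; exact: val_inj.
by exists P; split=> [w /PL|w]; rewrite -memL //; apply: HP.
Qed.

Lemma tree_size (P : {fset word}) (w : word) :
  tree P -> w \in P -> size w < #|` P|.
Proof.
move=> tP wP; pose s := [seq take i w | i <- iota 0 (size w).+1].
have us : uniq s.
  rewrite map_inj_in_uniq ?iota_uniq // => i j;
    rewrite !mem_iota !ltnS /= => iw jw.
  by move/(congr1 size); rewrite !size_takel.
have /(uniq_leq_size us) : {subset s <= enum_fset P}.
  by move=> _ /mapP[i _ ->]; apply: tree_prefix tP (prefix_take _ _) wP.
by rewrite size_map size_iota.
Qed.

Lemma leaf_size (P : {fset word}) (c : word) :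
  tree P -> c \in leaves P -> size c <= #|` P|.
Proof.
move=> tP cP; have := tree_size tP (leaf_par tP cP); rewrite size_take.
by case: c {cP} => //= x c; rewrite ltnSn.
Qed.

Lemma tree_of_counts (n : nat) (J : nat -> nat) :
    0 < n -> {homo J : i j / i <= j} -> (forall i, J i <= n) ->
    (forall i, i < n -> i < J i) ->
  exists P, [/\ tree P, #|` P| = n &
    forall c, c \in leaves P -> rank_node P c = J (rank_leaf P c)].
Proof.
move=> n0 Jmono Jn Jgt.
(* Accept a child of a node as long as fewer nodes have been accepted than [J] allows after the
   leaves already passed. *)
pose B S w := ((w == [::]) || (par w \in S)) && (#|` S| < J (rank_leaf S w)).
have [P [Psize HP]] := lex_recursion n B.
have BP w : w \in P -> B (node_below P w) w.
  by move=> wP; rewrite -HP // Psize.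
have tP : tree P.
  split=> [|w wP].
    rewrite HP // /B eqxx /=.
    by rewrite node_below_nil cardfs0 (leq_trans (Jgt _ n0)) ?Jmono.
  case/andP: (BP w wP) => /orP[/eqP e|]; last by rewrite mem_sep => /andP[].
  by rewrite e in wP *.
have BJ w : w \in P -> rank_node P w < J (rank_leaf P w).
  (* The root is handled apart: the set of nodes below it is empty, hence not a tree. *)
  move=> wP; case/andP: (BP w wP) => _; case: (eqVneq w [::]) => [->|w0].
    move=> _; rewrite /rank_node /rank -/(node_below P [::]) node_below_nil
      cardfs0.
    by apply: leq_trans (Jgt _ n0) _; apply: Jmono.
  have -> // : rank_leaf (node_below P w) w = rank_leaf P w.
  apply: rank_leaf_agree => // [|u uw]; first exact: tree_below.
  by rewrite mem_sep [X in _ && X]uw andbT.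
(* The greatest node was accepted when |P| - 1 nodes were present, under a quota of at most [n]. *)
have Pn : #|` P| <= n.
  have P0 : 0 < #|` P| by rewrite cardfs_gt0; apply/fset0Pn; exists [::];
    exact: tP.1.
  have [|w wP e] := @rank_surj _ _ _ lexw P #|` P|.-1 lexw_inj;
    first by rewrite prednK.
  have := leq_trans (BJ w wP) (Jn _).
  by rewrite /rank_node e prednK.
(* A leaf was rejected although its parent is a node, so the quota was exhausted. *)
have ge c : c \in leaves P -> J (rank_leaf P c) <= rank_node P c.
  move=> cP; have c0 := leaf_neq0 tP cP.
  have := leaf_notin cP; rewrite HP; last exact: leq_trans (leaf_size tP cP) Pn.
  rewrite /B (negbTE c0) /= mem_sep leaf_par //= [X in X && _]par_lt //=
    -leqNgt.
  have -> // : rank_leaf (node_below P c) c = rank_leaf P c.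
  apply: rank_leaf_agree => // [|u uw]; first exact: tree_below.
  by rewrite mem_sep [X in _ && X]uw andbT.
(* The last node below [c] was accepted under a quota that, by monotonicity, is at most that of
   [c]. *)
have le c : c \in leaves P -> rank_node P c <= J (rank_leaf P c).
  move=> cP; case e: (rank_node P c) => [//|m].
  have [|w wP ew] := @rank_surj _ _ _ lexw P m lexw_inj.
    by rewrite -e rank_node_lt_card.
  have wc : alpha_lt w c by rewrite /alpha_lt -(@rank_ltE _ _ _ lexw P w c wP)
    ew -/(rank_node _ _) e.
  have := BJ w wP; rewrite /rank_node ew => h; apply: leq_trans h _;
    apply: Jmono.
  by apply: rank_le; apply: ltW.
exists P; split=> // [|c cP]; last by apply/eqP; rewrite eqn_leq le ?ge.
apply/eqP; rewrite eqn_leq Pn leqNgt; apply/negP => lt.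
(* With fewer than [n] nodes, the last leaf, of rank |P|, would need more than |P| nodes below
   it. *)
have [|c cP ec] := @rank_surj _ _ _ lexw (leaves P) #|` P| lexw_inj.
  by rewrite card_leaves.
have := ge c cP; rewrite /rank_leaf ec => h.
by have := leq_trans (Jgt _ lt) (leq_trans h (rank_node_lt_card P c));
  rewrite ltnn.
Qed.

(** * Classes of a congruence and its search tree *)

Lemma congruence_class (E : word -> word -> Prop) (u v : word) :
  right_congruence E -> (E u v <-> E u = E v).
Proof.
move=> [[Er Es Et] _]; split=> [uv|->]; last exact: Er.
by apply/funext => w; apply/propext; split; [apply: Et; apply: Es|apply: Et].
Qed.

(** Trades the cardinality of a set of sets for a numbering of the classes, to which counting
    arguments apply. *)
Lemma class_index (E : word -> word -> Prop) (n : nat) :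
  right_congruence E ->
  (Defs.classes E #= `I_n)%card <->
  exists cl : word -> 'I_n,
    (forall u v, E u v <-> cl u = cl v) /\ forall i, exists u, cl u = i.
Proof.
move=> cE; have EE u v := congruence_class u v cE; split.
  case/card_set_bijP => f [ff fi fs].
  have fn u : f (E u) < n by apply: (ff (E u)); exists u.
  exists (fun u => Ordinal (fn u)); split=> [u v|i].
    rewrite EE; split=> [e|/(congr1 val)/= e]; first by apply: val_inj;
      rewrite /= e.
    by apply: fi => //; rewrite inE; [exists u|exists v].
  have [_ [u _ <-] e] := fs i (ltn_ord i).
  by exists u; apply: val_inj.
move=> [cl [clE cls]]; apply: card_esym; apply/card_set_bijP.
have clK u : [set v | cl v = cl u :> nat] = E u.
  by apply/funext => v; apply/propext; rewrite clE; split=> [e|->//];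
    apply: val_inj.
exists (fun i => [set v | cl v = i :> nat]); split=> [i /= ilt|i j|_ [u _ <-]].
- by have [u e] := cls (Ordinal ilt); exists u; rewrite // -clK e.
- rewrite !inE /= => ilt jlt eij; have [u e] := cls (Ordinal ilt).
  have : [set v | cl v = i :> nat] u by rewrite /= e.
  by rewrite eij /= e.
by exists (cl u); rewrite ?clK //=.
Qed.

Lemma representatives_card_le (n : nat) (cl : word -> 'I_n) (P : {fset word}) :
  {in P &, injective cl} -> #|` P| <= n.
Proof.
move=> ci; have : uniq [seq cl u | u <- enum_fset P] by rewrite
  (map_inj_in_uniq ci).
move/uniq_leq_size => /(_ (enum 'I_n)); rewrite size_map size_enum_ord; apply.
by move=> i _; rewrite mem_enum.
Qed.

Lemma representatives_card (n : nat) (cl : word -> 'I_n) (P : {fset word}) :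
    {in P &, injective cl} -> (forall i, exists2 p, p \in P & cl p = i) ->
  #|` P| = n.
Proof.
move=> ci cs; apply/eqP; rewrite eqn_leq (representatives_card_le ci) //=.
rewrite -{1}(size_enum_ord n) -(size_map cl (enum_fset P)).
apply: uniq_leq_size; first exact: enum_uniq.
by move=> i _; have [p pP <-] := cs i; apply: map_f.
Qed.

Lemma dfs_tree (E : word -> word -> Prop) (n : nat) :
    right_congruence E -> (Defs.classes E #= `I_n)%card ->
  exists P, [/\ tree P, #|` P| = n,
    forall u v, u \in P -> v \in P -> E u v -> u = v &
    forall c, c \in leaves P -> exists q, [/\ q \in P, alpha_lt q c & E q c]].
Proof.
move=> cE /(class_index n cE)[cl [clE cls]].
have [[Er Es Et] Em] := cE.
(* Depth-first search: a child of a node is accepted when no word accepted before is equivalent to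
   it. *)
pose B (S : {fset word}) w := ((w == [::]) || (par w \in S)) &&
  ~~ `[< exists2 q, q \in S & E q w >].
have [P [Psize HP]] := lex_recursion n B.
have BP w : w \in P -> B (node_below P w) w.
  by move=> wP; rewrite -HP // Psize.
have tP : tree P.
  split=> [|w wP].
    by rewrite HP // /B eqxx /=; apply/asboolPn => -[q]; rewrite node_below_nil.
  case/andP: (BP w wP) => /orP[/eqP e|]; last by rewrite mem_sep => /andP[].
  by rewrite e in wP *.
have distinct u v : u \in P -> v \in P -> E u v -> u = v.
  have lt u' v' : u' \in P -> v' \in P -> E u' v' -> ~~ alpha_lt u' v'.
    move=> uP vP e; case/andP: (BP v' vP) => _; apply: contraNN => uv.
    by apply/asboolP; exists u' => //; rewrite mem_sep uP.
  move=> uP vP e; case/or3P: (alpha_total u v) => [/eqP//|h|h].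
    by have := lt u v uP vP e; rewrite h.
  by have := lt v u vP uP (Es _ _ e); rewrite h.
have clP : {in P &, injective cl} by move=> u v uP vP /clE/(distinct _ _ uP vP).
(* This bound on the number of nodes keeps the leaves within the lengths covered by the
   recursion. *)
have Pn := representatives_card_le clP.
have leafE c : c \in leaves P -> exists q, [/\ q \in P, alpha_lt q c & E q c].
  move=> cP; have := leaf_notin cP; rewrite HP;
    last exact: leq_trans (leaf_size tP cP) Pn.
  rewrite /B mem_sep leaf_par // [X in _ || X]par_lt ?(leaf_neq0 tP cP) // orbT
    /= negbK.
  by case/asboolP => q; rewrite mem_sep => /andP[qP qc] Eq; exists q.
exists P; split=> //; apply: (representatives_card clP) => i.
(* Every class is reached by reading a word letter by letter, replacing each leaf met by its
   equivalent node. *)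
have [w <-] := cls i; elim/last_ind: w => [|w x [p pP e]].
  by exists [::] => //; exact: tP.1.
have Ep : E (rcons p x) (rcons w x) by rewrite -!cats1; apply: Em; apply/clE.
case pxP: (rcons p x \in P); first by exists (rcons p x) => //; apply/clE.
have [|q [qP _ Eq]] := leafE (rcons p x);
  first by rewrite mem_leaves // pxP par_rcons.
by exists q => //; apply/clE; apply: Et Ep.
Qed.

(** * Triplets *)

(** The function f on plain words, free of membership proofs, with a default value outside C. *)
Definition tf_word (T : triplet) (w : word) : word :=
  if insub w is Some c then val (tf (c : tC T)) else [::].

Lemma tf_wordE (T : triplet) (c : tC T) : tf_word T (val c) = val (tf c).
Proof. by rewrite /tf_word valK. Qed.

Lemma tf_word_in (T : triplet) (c : word) : c \in tC T -> tf_word T c \in tP T.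
Proof. by move=> cC; rewrite (tf_wordE [` cC]%fset); apply: valP. Qed.

Lemma triplet_ext (T T' : triplet) : tC T = tC T' -> tP T = tP T' ->
  (forall c, c \in tC T -> tf_word T c = tf_word T' c) -> T = T'.
Proof.
case: T => C P f; case: T' => C' P' f' /= eC eP; subst C' P' => H.
congr Triplet; apply/funext => c; apply: val_inj.
have := H (val c) (valP c).
by rewrite (@tf_wordE (Triplet f) c) (@tf_wordE (Triplet f') c).
Qed.

Lemma triplet_mk (P : {fset word}) (g : word -> word) :
  (forall c, c \in leaves P -> g c \in P) ->
  exists T, [/\ tP T = P, tC T = leaves P &
    forall c, c \in leaves P -> tf_word T c = g c].
Proof.
move=> gP.
exists (@Triplet (leaves P) P (fun c => [` gP (val c) (valP c)]%fset));
  split=> // c cP.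
by rewrite (@tf_wordE (Triplet _) [` cP]%fset).
Qed.

Definition tree_triplet (n : nat) (T : triplet) : Prop :=
  [/\ tree (tP T), tC T = leaves (tP T), #|` tP T| = n
    & forall c, c \in leaves (tP T) -> alpha_lt (tf_word T c) c].

Lemma valid_tripletP (n : nat) (T : triplet) : 0 < n ->
  valid_triplet n T <-> tree_triplet n T.
Proof.
move=> n0; split=> [[[pf _] cC eP lt]|[trP eC cP lt]].
  have memP w : (w \in tP T) <-> ~ exists2 c, c \in tC T & prefix c w.
    have -> : (w \in tP T) = [set` tP T] w :> Prop by [].
    rewrite eP; split; apply: contra_not; case=> c cT.
      by case/prefixP=> t ->; exists c => //; exists t.
    by case=> t _ <-; exists c => //; apply: prefix_prefix.
  have nP w : w \notin tP T -> exists2 c, c \in tC T & prefix c w.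
    by move=> /negP h; apply: contrapT => h'; apply/h/memP.
  (* The empty word is a prefix of every word, so it would be the only element of C, which has at
     least two. *)
  have c0 : [::] \notin tC T.
    apply/negP => c0; have : #|` tC T| <= #|` [fset ([::] : word)]%fset|.
      apply: fsubset_leq_card; apply/fsubsetP => c cT; rewrite in_fset1.
      by have := pf _ _ c0 cT;
        rewrite /proper_prefix prefix0s andTb negbK eq_sym.
    by rewrite cC cardfs1 ltnS leqNgt n0.
  have trP : tree (tP T).
    split=> [|w].
      by apply/memP => -[c cT]; rewrite prefixs0 => /eqP e; rewrite -e cT in c0.
    move=> /memP h; apply/memP => -[c cT cw]; apply: h; exists c => //.
    exact: prefix_trans cw (par_prefix w).
  have eC : tC T = leaves (tP T).
    apply/fsetP => w; rewrite mem_leaves //; apply/idP/andP => [wC|[wP pP]].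
      split; first by apply/negP => /memP; apply; exists w;
        rewrite ?prefix_refl.
      apply/memP => -[c cT cw]; have := pf _ _ cT wC.
      rewrite /proper_prefix (prefix_trans cw) ?par_prefix //= negbK => /eqP e.
      have := size_prefix cw; rewrite e size_take.
      by case: (w) wC c0 => [->//|x v _ _] /=; rewrite ltnSn ltnn.
    have [c cC' /prefixP[t e]] := nP w wP; case/lastP: t e => [|t x] e.
      by rewrite e cats0.
    case/memP: pP; exists c => //; rewrite e -rcons_cat par_rcons;
      exact: prefix_prefix.
  split=> //; first by have := card_leaves trP; rewrite -eC cC => -[].
  by rewrite -eC => c cT; rewrite (tf_wordE [` cT]%fset); apply: lt.
split.
- have pf : prefix_free [set` tC T].
    move=> u v; rewrite /= eC /proper_prefix => uC vC; apply/negP => /andP[p].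
    by rewrite (leaf_prefix_eq trP uC vC p) eqxx.
  split=> // D pD [CD /existsNP[u /not_implyP[uD uC]]].
  (* An additional word of [D] either is a node, hence a proper prefix of a leaf, or has a leaf as a
     prefix. *)
  have [uP|uP] := boolP (u \in tP T).
    have [j jC] := leaf_ray trP uP.
    have jD : D (u ++ nseq j.+1 false) by apply: CD; rewrite /= eC.
    have := pD _ _ uD jD;
      rewrite /proper_prefix prefix_prefix /= negbK => /eqP e.
    by have := nseq_alpha_lt u j; rewrite -e alpha_irr.
  have [c cL cu] := leaf_below trP uP.
  have cD : D c by apply: CD; rewrite /= eC.
  have := pD _ _ cD uD; rewrite /proper_prefix cu /= negbK => /eqP e.
  by apply: uC; rewrite /= -e eC.
- by rewrite eC card_leaves // cP.
- apply/funext => w; apply/propext; split=> [wP [c cC [t _ e]]|h].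
    rewrite /= eC in cC.
    by have := leaf_prefix trP cC (prefix_prefix c t); rewrite e wP.
  apply: contrapT => /negP wP; have [c cL /prefixP[t e]] := leaf_below trP wP.
  by apply: h; exists c; rewrite /= ?eC //; exists t.
- by move=> c; rewrite -tf_wordE; apply: lt; rewrite -eC; apply: valP.
Qed.

(** Transitions of the automaton with the nodes as states: tree edges, and edges outside the tree
    given by f. *)
Definition step (T : triplet) (p : word) (x : bool) : word :=
  if rcons p x \in tP T then rcons p x else tf_word T (rcons p x).

Definition run (T : triplet) (w : word) : word := foldl (step T) [::] w.

Lemma run_rcons (T : triplet) (w : word) (x : bool) :
  run T (rcons w x) = step T (run T w) x.
Proof. by rewrite /run foldl_rcons. Qed.

Lemma run_in (T : triplet) (w : word) :
  tree (tP T) -> tC T = leaves (tP T) -> run T w \in tP T.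
Proof.
move=> trP eC; elim/last_ind: w => [|w x IH]; first exact: trP.1.
rewrite run_rcons /step; case: ifPn => // n; apply: tf_word_in.
by rewrite eC mem_leaves // n par_rcons.
Qed.

Lemma run_id (T : triplet) (p : word) : tree (tP T) -> p \in tP T ->
  run T p = p.
Proof.
move=> trP; elim/last_ind: p => // p x IH pxP.
by rewrite run_rcons IH ?/step ?pxP //; have := trP.2 _ pxP; rewrite par_rcons.
Qed.

Lemma right_congruence_generated (R : word -> word -> Prop) :
  right_congruence (generated_congruence R).
Proof.
split; first split.
- by move=> u E [[Er _ _] _] _; apply: Er.
- by move=> u v h E cE HR; have [[_ Es _] _] := cE; exact: (Es _ _ (h E cE HR)).
- move=> u v w h h' E cE HR; have [[_ _ Et] _] := cE.
  exact: (Et _ v _ (h E cE HR) (h' E cE HR)).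
by move=> u v w h E cE HR; exact: (cE.2 _ _ _ (h E cE HR)).
Qed.

(** Having the same run is a right congruence containing the generating relations; conversely, each
    word is congruent to the node its run reaches. *)
Lemma triplet_congruenceE (T : triplet) (u v : word) :
  tree (tP T) -> tC T = leaves (tP T) ->
  triplet_congruence T u v <-> run T u = run T v.
Proof.
move=> trP eC; split.
  move=> h; apply: (h (fun u v => run T u = run T v)).
    split; first by split=> [x|x y /= ->|x y z /= -> ->].
    by move=> x y w /= e; rewrite /run !foldl_cat -!/(run _ _) e.
  move=> x y [c [-> ->]]; have := valP c; rewrite [X in _ \in X]eC => cL.
  rewrite [RHS]run_id //; last exact: valP.
  have pP := leaf_par trP cL; have := leaf_notin cL; have := leaf_neq0 trP cL.
  rewrite -tf_wordE; case/lastP: (val c) pP => // p x' + _;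
    rewrite par_rcons => pP n.
  by rewrite run_rcons run_id // /step (negbTE n).
have [[Er Es Et] Em] := right_congruence_generated
   (fun u v => exists c : tC T, u = val c /\ v = val (tf c)).
suff H w : triplet_congruence T w (run T w).
  by move=> e; apply: (Et _ _ _ (H u)); rewrite e; exact: (Es _ _ (H v)).
elim/last_ind: w => [|w x IH]; first exact: Er.
apply: (Et _ (rcons (run T w) x)); first by rewrite -!cats1; apply: Em.
rewrite run_rcons /step; case: ifPn => n; first exact: Er.
have cT : rcons (run T w) x \in tC T by rewrite eC mem_leaves // n par_rcons
  run_in.
move=> E cE; apply; exists [` cT]%fset; split=> //.
by rewrite (tf_wordE [` cT]%fset).
Qed.

(** * Regularity *)

Lemma class_mulE (E : word -> word -> Prop) (u w : word) :
  right_congruence E -> class_mul E w (E u) = E (u ++ w).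
Proof.
move=> [[Er Es Et] Em]; apply/funext => v; apply/propext;
  split=> [[u' uu' e]|e].
  exact: (Et _ _ _ (Em _ _ w uu') e).
by exists u.
Qed.

(** An injective map of a finite set into itself is onto, so cancelling one letter suffices. *)
Lemma regularP (E : word -> word -> Prop) (n : nat) :
  right_congruence E -> (Defs.classes E #= `I_n)%card ->
  regular E <-> forall u v x, E (rcons u x) (rcons v x) -> E u v.
Proof.
move=> cE nE; have EE u v := congruence_class u v cE; split=> [rE u v x|can w].
  rewrite -!cats1 => /EE e; have [_ inj _] := rE [:: x].
  apply/EE; apply: inj; rewrite ?inE; [by exists u|by exists v|].
  by rewrite !class_mulE.
have {}can u v : E (u ++ w) (v ++ w) -> E u v.
  elim/last_ind: w => [|w x IH]; first by rewrite !cats0.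
  by rewrite -!rcons_cat => /can.
have [cl [clE cls]] := (class_index n cE).1 nE.
split.
- by move=> _ [u _ <-]; rewrite class_mulE //; exists (u ++ w).
- move=> K K'; rewrite !inE => -[u _ <-] [v _ <-];
  rewrite !class_mulE // => /EE/can.
  by move/EE.
- have [r rE] := choice cls.
  pose g i := cl (r i ++ w).
  have gi : injective g.
    by move=> i j /clE/can/clE; rewrite !rE.
  move=> _ [u _ <-]; have /mapP[i _ e] : cl u \in codom g by rewrite injF_onto.
  exists (E (r i)); first by exists (r i).
  by rewrite class_mulE //; apply/esym/EE/clE.
Qed.

Lemma triplet_classes (n : nat) (T : triplet) :
  tree (tP T) -> tC T = leaves (tP T) -> #|` tP T| = n ->
  (Defs.classes (triplet_congruence T) #= `I_n)%card.
Proof.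
move=> trP eC cP; apply/class_index; first exact: right_congruence_generated.
have rn w : rank lexw (tP T) (run T w) < n by rewrite -cP rank_card ?run_in.
exists (fun w => Ordinal (rn w)); split=> [u v|i].
  rewrite triplet_congruenceE //; split=> [e|/(congr1 val)/= e].
    by apply: val_inj; rewrite /= e.
  by apply: (rank_inj lexw_inj _ _ e); exact: run_in.
have [|p pP e] := @rank_surj _ _ _ lexw (tP T) i lexw_inj; first by rewrite cP.
by exists p; apply: val_inj; rewrite /= run_id.
Qed.

Lemma strip_rcons_id (w : word) (x : bool) : strip (rcons w x) = rcons w x -> x.
Proof.
case: x => //; rewrite strip_rcons => /(congr1 size); rewrite size_rcons => e.
by have := size_prefix (prefix_strip w); rewrite e ltnn.
Qed.

Lemma rcons_strip (w : word) :
  rcons w false = strip w ++ nseq (size w - size (strip w)).+1 false.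
Proof. by rewrite cat_nseqS -strip_decomp. Qed.

Lemma apower_rcons (w : word) (x : bool) :
  apower (rcons w x) = ~~ x && (strip w == [::]).
Proof. by rewrite apowerE strip_rcons; case: x => //; case: w. Qed.

(* In the regular case the a-edge leaving the last node of the chain w, wa, ...,
   wa^{j-1} goes back to w. *)
Definition closes_chains (T : triplet) : Prop :=
  forall p, rcons p false \in leaves (tP T) ->
    tf_word T (rcons p false) = strip p.

Definition phi_word (T : triplet) (c : word) : option word :=
  if apower c then None else Some (tf_word T c).

(** Strong induction on the rank of the leaf pa, with target v. The chain of letters a from v leaves
    the tree at pa or earlier; if earlier, by induction it returns to v, and two a-edges enter v. *)
Lemma step_inj_closes (T : triplet) :
    tree (tP T) -> tC T = leaves (tP T) ->
    (forall c, c \in leaves (tP T) -> alpha_lt (tf_word T c) c) ->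
    (forall p q x, p \in tP T -> q \in tP T -> step T p x = step T q x ->
      p = q) ->
  closes_chains T.
Proof.
move=> trP eC lt inj p; move e : (rank_leaf (tP T) (rcons p false)) => m.
elim/ltn_ind: m p e => m IH p em cP; set v := tf_word _ _.
have pP : p \in tP T by have := leaf_par trP cP; rewrite par_rcons.
have stp : step T p false = v by rewrite /step (negbTE (leaf_notin cP)).
have vP : v \in tP T by apply: tf_word_in; rewrite eC.
(* If v ended with a, its tree edge and the edge from [p] would both enter v with letter a, making
   the leaf pa a node. *)
have sv : strip v = v.
  case/lastP E : v => [//|v' []]; first by rewrite strip_rcons.
  have v'P : v' \in tP T by have := trP.2 _ vP; rewrite E par_rcons.
  have := inj p v' false pP v'P; rewrite stp /step -E vP => /(_ erefl) pv.
  by have := leaf_notin cP; rewrite pv -E vP.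
have [j jP] := leaf_ray trP vP.
have vc : alpha_lt (strip v) (rcons p false) by rewrite sv; apply: lt.
have [e|jlt] := leaf_ray_le trP cP jP vc.
  by move: e; rewrite cat_nseqS => /rcons_inj[<-]; rewrite strip_cat sv.
rewrite cat_nseqS in jP jlt.
have := IH _ _ _ erefl jP; rewrite strip_cat sv -em => /(_ (rank_lt jP jlt)) e.
have stj : step T (v ++ nseq j false) false = v by rewrite /step (negbTE
  (leaf_notin jP)).
have vj : v ++ nseq j false \in tP T by have := leaf_par trP jP;
  rewrite par_rcons.
have e' := inj _ _ _ pP vj (etrans stp (esym stj)).
by rewrite -e' alpha_irr in jlt.
Qed.

Lemma leaf_apower (P : {fset word}) (c c' : word) : tree P ->
  c \in leaves P -> c' \in leaves P -> apower c -> apower c' -> c = c'.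
Proof.
move=> trP.
suff H d d' : d \in leaves P -> d' \in leaves P -> apower d ->
  d = d' \/ alpha_lt d d'.
  move=> cP cP' a a'; have [//|h] := H c c' cP cP' a.
  by have [//|h'] := H c' c cP' cP a'; rewrite (alpha_asym h) in h'.
move=> dP dP' /eqP e; rewrite e; rewrite e in dP.
apply: (leaf_ray_le (w := [::]) trP dP' dP).
by rewrite alpha_nil (leaf_neq0 trP).
Qed.

(** Leaves with the same last letter are separated by injectivity of that letter; the case of
    different last letters is [mixed]. *)
Lemma step_inj_phi_inj (T : triplet) :
    tree (tP T) -> tC T = leaves (tP T) -> closes_chains T ->
    (forall p q x, p \in tP T -> q \in tP T -> step T p x = step T q x ->
      p = q) ->
  {in leaves (tP T) &, injective (phi_word T)}.
Proof.
move=> trP eC close inj.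
have stepL p x : rcons p x \in leaves (tP T) ->
  step T p x = tf_word T (rcons p x).
  by move=> cP; rewrite /step (negbTE (leaf_notin cP)).
have parL p x : rcons p x \in leaves (tP T) -> p \in tP T.
  by move=> cP; have := leaf_par trP cP; rewrite par_rcons.
(* The common target would be the nonempty word [strip p], which ends with b and is already entered
   by a tree edge with letter b. *)
have mixed p q : rcons p false \in leaves (tP T) ->
  rcons q true \in leaves (tP T) ->
    ~~ apower (rcons p false) ->
      tf_word T (rcons p false) <> tf_word T (rcons q true).
  move=> cP cQ; rewrite apower_rcons /= => n e; have := close p cP;
    rewrite e => {}e.
  have := tf_word_in (T := T) (c := rcons q true); rewrite eC => /(_ cQ);
    rewrite e.
  case/lastP E : (strip p) n (stripK p) => [//|w x] _;
    rewrite -E stripK E => sw.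
  have {sw} xt : x by apply: (@strip_rcons_id w); rewrite -E stripK.
  move=> wP; have wP' : w \in tP T by have := trP.2 _ wP; rewrite par_rcons.
  rewrite {x}xt in E wP *; have := inj w q true wP' (parL _ _ cQ).
  rewrite (stepL q true cQ) e E /step wP => /(_ erefl) wq.
  by have := leaf_notin cQ; rewrite -wq wP.
move=> c c' cP cP'; rewrite /phi_word.
case: ifP => ac; case: ifP => ac' //.
  by move=> _; apply: (leaf_apower trP cP cP' ac ac').
case.
case/lastP: c cP ac => [/(leaf_neq0 trP)//|p x] cP ac.
case/lastP: c' cP' ac' => [/(leaf_neq0 trP)//|q y] cP' ac'.
case: (eqVneq x y) cP' ac' => [<-|n] cP' ac'.
  by rewrite -!stepL // => /(inj _ _ _ (parL _ _ cP) (parL _ _ cP')) ->.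
case: x y cP ac n cP' ac' => [] [] // cP ac _ cP' ac' e.
  by case: (mixed q p cP' cP); rewrite ?ac'.
by case: (mixed p q cP cP'); rewrite ?ac.
Qed.

Lemma phi_inj_step_inj (T : triplet) :
    tree (tP T) -> tC T = leaves (tP T) -> closes_chains T ->
    {in leaves (tP T) &, injective (phi_word T)} ->
  forall p q x, p \in tP T -> q \in tP T -> step T p x = step T q x -> p = q.
Proof.
move=> trP eC close inj.
have inL p x : p \in tP T -> rcons p x \notin tP T ->
  rcons p x \in leaves (tP T).
  by move=> pP n; rewrite mem_leaves // n par_rcons.
(* For the letter a, the target of the leaf is stripped and cannot end with a. For b, the leaf
   ending the chain from pb already has pb as its value. *)
have mixed p q x : rcons p x \in tP T -> rcons q x \in leaves (tP T) ->
    rcons p x <> tf_word T (rcons q x).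
  case: x => pP qP e; last first.
    by have := @strip_rcons_id p false;
      rewrite {1}e close // stripK -close // -e => /(_ erefl).
  have [j jP] := leaf_ray trP pP; rewrite cat_nseqS in jP.
  have := inj _ _ jP qP; rewrite /phi_word !apower_rcons strip_cat.
  rewrite strip_rcons close // strip_cat strip_rcons -e.
  have -> : (rcons p true == [::]) = false by case: (p).
  by move=> /(_ erefl)/rcons_inj[].
move=> p q x pP qP; rewrite /step; case: ifPn => np; case: ifPn => nq.
- by case/rcons_inj.
- by move/(mixed _ _ _ np (inL _ _ qP nq)).
- by move/esym/(mixed _ _ _ nq (inL _ _ pP np)).
have pL := inL _ _ pP np; have qL := inL _ _ qP nq; move=> e.
(* [phi_word] differs from f only on powers of a, so both leaves must be treated alike. *)
suff a : apower (rcons p x) = apower (rcons q x).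
  by have := inj _ _ pL qL; rewrite /phi_word a e => /(_ erefl)/rcons_inj[].
case: x np nq pL qL e => np nq pL qL; first by rewrite !apower_rcons.
by rewrite !close // !apower_rcons => ->.
Qed.

(** * The permutation of a triplet *)

(** The relation theta(i) = j read through ranks, without choosing enumerations. *)
Definition perm_word (n : nat) (T : triplet) (theta : 'S_n.+1) : Prop :=
  forall c, c \in leaves (tP T) ->
    theta (inord (rank_leaf (tP T) c)) = rank_tilde (tP T) (phi_word T c) :>
      nat.

Lemma rank_leaf_lt (n : nat) (P : {fset word}) (c : word) : tree P ->
  #|` P| = n -> c \in leaves P -> rank_leaf P c < n.+1.
Proof. by move=> trP cP cL; rewrite -cP -card_leaves // rank_card. Qed.

Lemma rank_tilde_lt (n : nat) (P : {fset word}) (q : option word) :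
  #|` P| = n -> q \in tilde P -> rank_tilde P q < n.+1.
Proof. by move=> cP qP; rewrite -cP -card_tilde rank_card. Qed.

Lemma phi_wordE (T : triplet) (c : tC T) : phi c = phi_word T (val c).
Proof. by rewrite /phi /phi_word tf_wordE. Qed.

Lemma phi_word_tilde (T : triplet) (c : word) :
  c \in tC T -> phi_word T c \in tilde (tP T).
Proof. by move=> cT; rewrite mem_tilde /phi_word; case: ifP => // _;
  apply: tf_word_in. Qed.

Lemma tildePE (T : triplet) : tildeP T = [set` tilde (tP T)].
Proof.
apply/funext => q; apply/propext; rewrite /= mem_tilde; case: q => [u|];
  split=> //.
- by case=> [[v vP [<-]]|].
- by move=> uP; left; exists u.
- by move=> _; right.
Qed.

Lemma triplet_permP (n : nat) (T : triplet) (theta : 'S_n.+1) :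
    tree (tP T) -> tC T = leaves (tP T) -> #|` tP T| = n ->
  triplet_perm T theta <-> perm_word T theta.
Proof.
move=> trP eC cP.
have xE : xtwisted_lt = (fun p q => (twisted_key p < twisted_key q)%O).
  by apply/funext => p; apply/funext => q; apply/propext; apply: xtwisted_ltE.
split.
  case=> c [p [ec ep tE]] x xL.
  have ep' : increasing_enumeration (fun p q =>
    (twisted_key p < twisted_key q)%O)
     [set` tilde (tP T)] p by rewrite -xE -tildePE.
  have ec' : increasing_enumeration (fun u v => (lexw u < lexw v)%O)
      [set` leaves (tP T)] (fun i => val (c i)).
    case: ec => inc ran; split=> //; rewrite eqEsubset;
      split=> [_ [i _ <-]|y /= yL].
      by rewrite /= -eC; apply: valP.
    have yC : y \in tC T by rewrite eC.
    have : [set: tC T] [` yC]%fset by [].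
    by rewrite -ran => -[i _ e]; exists i => //; rewrite e.
  have : [set` leaves (tP T)] x by [].
  rewrite -ec'.2 => -[i _ <-].
  rewrite /rank_leaf (enumeration_rank i ec') inord_val -phi_wordE.
  by rewrite ((tE i (theta i)).1 erefl) /rank_tilde (enumeration_rank (theta i)
    ep').
move=> tE.
have [s sE] := @enumeration_exists _ _ _ lexw (leaves (tP T)) n.+1 lexw_inj
  (etrans (card_leaves trP) (congr1 S cP)).
have [p pE] := @enumeration_exists _ _ _ twisted_key (tilde (tP T)) n.+1
  twisted_key_inj
  (etrans (card_tilde _) (congr1 S cP)).
have sC i : s i \in tC T.
  have : range s (s i) by exists i.
  by rewrite sE.2 /= eC.
have sL i : s i \in leaves (tP T) by rewrite -eC.
exists (fun i => [` sC i]%fset), p; split.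
- split=> [i j ij|]; first exact: sE.1.
  rewrite eqEsubset; split=> // c _.
  have : [set` leaves (tP T)] (val c) by rewrite /= -eC; apply: valP.
  by rewrite -sE.2 => -[i _ e]; exists i => //; apply: val_inj.
- by rewrite xE tildePE.
move=> i j; rewrite phi_wordE /=.
have pi : p j \in tilde (tP T).
  have : range p (p j) by exists j.
  by rewrite pE.2.
have := tE _ (sL i); rewrite /rank_leaf (enumeration_rank i sE) inord_val => e.
split=> [tij|e'].
  apply: (rank_inj twisted_key_inj (phi_word_tilde (sC i)) pi).
  by rewrite (enumeration_rank j pE) -tij e.
by apply: val_inj; rewrite /= e e' /rank_tilde (enumeration_rank j pE).
Qed.

Lemma perm_word_exists (n : nat) (T : triplet) :
    tree (tP T) -> tC T = leaves (tP T) -> #|` tP T| = n ->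
    {in leaves (tP T) &, injective (phi_word T)} ->
  exists theta : 'S_n.+1, perm_word T theta.
Proof.
move=> trP eC cP inj.
have /choice[s sP] : forall i : 'I_n.+1, exists c,
  c \in leaves (tP T) /\ rank_leaf (tP T) c = i.
  move=> i; have [|c cL e] := @rank_surj _ _ _ lexw (leaves (tP T)) i lexw_inj;
    last by exists c.
  by rewrite card_leaves // cP.
have til i : phi_word T (s i) \in tilde (tP T).
  by apply: phi_word_tilde; rewrite eC; case: (sP i).
pose g i : 'I_n.+1 := inord (rank_tilde (tP T) (phi_word T (s i))).
have gE i : g i = rank_tilde (tP T) (phi_word T (s i)) :> nat.
  by rewrite inordK // rank_tilde_lt.
have gi : injective g.
  move=> i j /(congr1 val);
    rewrite /= !gE => /(rank_inj twisted_key_inj (til i) (til j)).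
  have [si ei] := sP i; have [sj ej] := sP j; move/(inj _ _ si sj) => e.
  by apply: val_inj; rewrite /= -ei -ej e.
exists (perm gi) => c cL; rewrite permE gE; congr rank_tilde; congr phi_word.
have [si ei] := sP (inord (rank_leaf (tP T) c)).
apply: (rank_inj lexw_inj si cL); rewrite -!/(rank_leaf _ _) ei inordK //.
exact: rank_leaf_lt.
Qed.

(** * Prefix maxima and indecomposability *)

Definition prefix_max (n : nat) (theta : 'S_n.+1) (i : nat) : nat :=
  \max_(l < n.+1 | l <= i) theta l.

Lemma prefix_max_ge (n : nat) (theta : 'S_n.+1) (i : nat) (l : 'I_n.+1) :
  l <= i -> theta l <= prefix_max theta i.
Proof. by move=> h; rewrite /prefix_max (bigD1 l) //= leq_maxl. Qed.

Lemma prefix_max_attained (n : nat) (theta : 'S_n.+1) (i : nat) :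
  exists2 l : 'I_n.+1, l <= i & prefix_max theta i = theta l.
Proof.
have [|l li e] := @eq_bigmax_cond _ [pred l : 'I_n.+1 | l <= i] (fun l =>
  nat_of_ord (theta l)).
  by apply/card_gt0P; exists ord0.
by exists l.
Qed.

Lemma perm_word_rank_node (n : nat) (T : triplet) (theta : 'S_n.+1) (c : word) :
    tree_triplet n T ->
    closes_chains T -> perm_word T theta -> c \in leaves (tP T) ->
  rank_node (tP T) c = prefix_max theta (rank_leaf (tP T) c).
Proof.
move=> trT close tE cL; have [trP eC cP lt] := trT; apply/eqP; rewrite eqn_leq;
  apply/andP; split.
  (* The last element of the segment of [c] is the image under phi of a leaf not after [c], since
     chains close. *)
  have [w [j [sw c'L c'c <-]]] := rank_node_attained trP cL.
  have -> : head_node w = phi_word T (w ++ nseq j.+1 false).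
    rewrite /phi_word apowerE strip_cat sw /head_node; case: eqP => // _.
    by rewrite cat_nseqS in c'L *; rewrite close // strip_cat sw.
  rewrite -tE //; apply: prefix_max_ge; rewrite inordK ?rank_leaf_lt //.
  by apply: rank_le; case: c'c => [->//|/ltW].
(* Conversely, f(c') < c' puts phi(c') in the segment of c', which grows with the leaf. *)
apply/bigmax_leqP => l li.
have [|c' c'L e] := @rank_surj _ _ _ lexw (leaves (tP T)) l lexw_inj.
  by rewrite card_leaves // cP.
have := tE c' c'L; rewrite /rank_leaf e inord_val => ->.
apply: leq_trans (_ : rank_node (tP T) c' <= _).
  rewrite rank_tilde_le ?phi_word_tilde ?eC // /phi_word.
  case: ifP => _ /=; first by rewrite alpha_nil (leaf_neq0 trP).
  by rewrite (alpha_strip_leaf trP c'L) ?lt // tf_word_in ?eC.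
apply: rank_le; rewrite leNgt; apply/negP => /(@rank_lt _ _ _ lexw _ _ _ cL).
by rewrite e ltnNge li.
Qed.

(** If {0, ..., i} were stable with i < n, the prefix maximum J_i would be at most i, against
    [rank_leaf_lt_node]. *)
Lemma perm_word_indecomposable (n : nat) (T : triplet) (theta : 'S_n.+1) :
    tree_triplet n T ->
    closes_chains T -> perm_word T theta ->
  indecomposable theta.
Proof.
move=> trT close tE; have [trP eC cP lt] := trT; case=> [//|i] /andP[_ ilt] eq.
have leaf k : k < n.+1 ->
  exists2 c, c \in leaves (tP T) & rank_leaf (tP T) c = k.
  by move=> kn; apply: rank_surj => //; rewrite card_leaves // cP.
have [c cL ec] := leaf i (ltnW ilt); have [c1 c1L ec1] := leaf i.+1 ilt.
have cc1 : alpha_lt c c1.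
  by rewrite /alpha_lt -(@rank_ltE _ _ _ lexw _ _ _ cL) -!/(rank_leaf _ _) ec
    ec1.
have := rank_leaf_lt_node trP cL c1L cc1.
rewrite (perm_word_rank_node trT close tE cL) ec.
have [l li ->] := prefix_max_attained theta i.
have : theta l \in [set j : 'I_n.+1 | j < i.+1]%SET by rewrite -eq imset_f //
  inE ltnS.
by rewrite inE ltnS ltnNge => ->.
Qed.

Lemma perm_word_inj (n : nat) (T T' : triplet) (theta : 'S_n.+1) :
    tree_triplet n T ->
    closes_chains T -> perm_word T theta ->
    tree_triplet n T' ->
    closes_chains T' -> perm_word T' theta ->
  T = T'.
Proof.
move=> trT close tE trT' close' tE'.
have [trP eC cP _] := trT; have [trP' eC' cP' _] := trT'.
have eP : tP T = tP T'.
  apply: tree_unique => // [|c c' cL cL' e]; first by rewrite cP.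
  by rewrite (perm_word_rank_node trT close tE cL) e -(perm_word_rank_node
    trT').
apply: triplet_ext; rewrite ?eC ?eC' ?eP // => c cL.
have cL0 : c \in leaves (tP T) by rewrite eP.
have : phi_word T c = phi_word T' c.
  apply: (rank_inj twisted_key_inj (A := tilde (tP T'))).
  - by rewrite -eP phi_word_tilde // eC.
  - by rewrite phi_word_tilde // eC'.
  by rewrite -!/(rank_tilde _ _) -tE' // -{1}eP -tE // eP.
(* On the power of a in C, phi hides f; there chain closing forces the empty word. *)
rewrite /phi_word; case: ifP => [ac _|_ []//].
case/lastP: c cL cL0 ac => [/(leaf_neq0 trP')//|p x] cL cL0.
rewrite apower_rcons => /andP[/negbTE xf /eqP sp].
by rewrite xf in cL cL0 *; rewrite close // close'.
Qed.

(** Otherwise theta maps {0, ..., i} into itself, hence onto itself by cardinality. *)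
Lemma prefix_max_indecomposable (n : nat) (theta : 'S_n.+1) (i : nat) :
  indecomposable theta -> i < n -> i < prefix_max theta i.
Proof.
move=> ind ilt; rewrite ltnNge; apply/negP => le; apply: (ind i.+1);
  first by rewrite ltnS.
apply/eqP; rewrite eqEcard card_imset; last exact: perm_inj.
rewrite leqnn andbT; apply/fintype.subsetP => _ /imsetP[l + ->].
by rewrite !inE !ltnS => li; apply: leq_trans le; apply: prefix_max_ge.
Qed.

Lemma perm_word_surj (n : nat) (theta : 'S_n.+1) : 0 < n ->
  indecomposable theta ->
  exists T, [/\ tree_triplet n T, closes_chains T, {in leaves (tP T) &,
    injective (phi_word T)} &
    perm_word T theta].
Proof.
move=> n0 ind; have [|i|i lt|P [trP cP JP]] := @tree_of_counts n (prefix_max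
  theta) n0.
- move=> i j ij; apply/bigmax_leqP => l li; apply: prefix_max_ge;
  exact: leq_trans li ij.
- by apply/bigmax_leqP => l _; rewrite -ltnS.
- exact: prefix_max_indecomposable.
have leaf k : k < n.+1 -> exists2 c, c \in leaves P & rank_leaf P c = k.
  by move=> kn; apply: rank_surj => //; rewrite card_leaves // cP.
pose i c : 'I_n.+1 := inord (rank_leaf P c).
have iE c : c \in leaves P -> i c = rank_leaf P c :> nat.
  by move=> cL; rewrite inordK // rank_leaf_lt.
have /choice[phi phiP] : forall c, exists q,
  q \in tilde P /\ rank_tilde P q = theta (i c).
  move=> c; have [|q qP e] := @rank_surj _ _ _ twisted_key (tilde P) (theta (i
    c)) twisted_key_inj.
    by rewrite card_tilde cP.
  by exists q.
have phi_inj : {in leaves P &, injective phi}.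
  move=> c c' cL cL' e; have : theta (i c) = theta (i c').
    by apply: val_inj; have [_ /= <-] := phiP c; have [_ /= <-] := phiP c';
      rewrite e.
  move/perm_inj/(congr1 val); rewrite /= !iE //; exact: (rank_inj lexw_inj).
(* A value of theta is at most the prefix maximum there, so phi(c) lies in the segment of [c]; this
   will give f(c) < c. *)
have key_lt c : c \in leaves P -> alpha_lt (twisted_key (phi c)).1 c.
  move=> cL; have [qP e] := phiP c; rewrite -(rank_tilde_le trP cL qP) e JP //.
  by apply: prefix_max_ge; rewrite iE.
(* At a leaf ending with a the prefix maximum jumps, so theta takes this maximum there, and the
   element of that rank is given by [rank_head_node]. *)
have head p : rcons p false \in leaves P ->
  phi (rcons p false) = head_node (strip p).
  move=> cL; have [qP e] := phiP (rcons p false).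
  have sP : strip p \in P.
    by apply: (tree_prefix trP (prefix_strip p)); have := leaf_par trP cL;
      rewrite par_rcons.
  apply: (rank_inj twisted_key_inj qP (head_tilde sP));
    rewrite -!/(rank_tilde _ _) e.
  have := cL; rewrite {1}rcons_strip => /(rank_head_node trP)/(_ (stripK p)) ->.
  rewrite -rcons_strip JP //.
  have [l li el] := prefix_max_attained theta (rank_leaf P (rcons p false)).
  rewrite el; congr (nat_of_ord (theta _)); apply: val_inj; rewrite /= iE //.
  apply/eqP; rewrite eqn_leq li andbT leqNgt; apply/negP => llt.
  have [c' c'L e'] := leaf l (ltn_ord l).
  have c'lt : alpha_lt c' (rcons p false).
    by rewrite /alpha_lt -(@rank_ltE _ _ _ lexw _ _ _ c'L) -!/(rank_leaf _ _)
      e'.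
  have := rank_node_lt trP c'L cL c'lt; rewrite !JP // el ltnNge e'.
  by rewrite prefix_max_ge.
(* The symbol a^{-1} stands for the empty word, the value required of f on the power of a in C. *)
pose g c := if phi c is Some u then u else [::].
have gP c : c \in leaves P -> g c \in P.
  move=> cL; have [] := phiP c; rewrite mem_tilde /g; case: (phi c) => // _ _.
  exact: trP.1.
have [T [eP eC gE]] := triplet_mk gP.
have close : closes_chains T.
  move=> p; rewrite eP => cL; rewrite gE // /g head // /head_node.
  by case: eqP.
(* By [head], phi takes the value a^{-1} on the leaf that is a power of a, and by injectivity
   nowhere else. *)
have phiE c : c \in leaves P -> phi_word T c = phi c.
  move=> cL; rewrite /phi_word gE // /g; case: ifP => ac.
    case/lastP: c cL ac => [/(leaf_neq0 trP)//|p x] cL; rewrite apower_rcons.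
    case/andP => /negbTE xf /eqP sp; rewrite xf in cL *.
    by rewrite head // sp.
  case e : (phi c) => [//|]; have [j jL] := leaf_ray trP trP.1.
  have h : phi ([::] ++ nseq j.+1 false) = phi c.
    by rewrite e cat_nseqS head -?cat_nseqS // strip_cat.
  have ec := phi_inj _ _ jL cL h.
  by rewrite -ec apowerE strip_cat in ac.
exists T; split=> //; rewrite /tree_triplet ?eP.
- split=> // c cL; rewrite -(alpha_strip_leaf trP cL) gE ?gP // /g.
  by have := key_lt c cL; case: (phi c).
- by move=> c c' cL cL'; rewrite !phiE //; apply: phi_inj.
by move=> c; rewrite eP => cL; rewrite phiE //; have [_ ->] := phiP c.
Qed.

(** * Regular congruences, their triplets and the bijection *)

Lemma triplet_regularP (n : nat) (T : triplet) : tree_triplet n T ->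
  regular (triplet_congruence T) <->
  closes_chains T /\ {in leaves (tP T) &, injective (phi_word T)}.
Proof.
move=> [trP eC cP lt].
have cE : right_congruence (triplet_congruence T) := right_congruence_generated
  _.
have nE := triplet_classes trP eC cP.
have gE u v := triplet_congruenceE u v trP eC.
split=> [/(regularP cE nE) can|[close inj]]; last first.
  apply/(regularP cE nE) => u v x; rewrite !gE !run_rcons.
  by apply: (phi_inj_step_inj trP eC close inj); apply: run_in.
have inj p q x : p \in tP T -> q \in tP T -> step T p x = step T q x -> p = q.
  move=> pP qP e; rewrite -(run_id trP pP) -(run_id trP qP).
  by apply/gE; apply: (can _ _ x); apply/gE; rewrite !run_rcons !run_id.
have close := step_inj_closes trP eC lt inj.
by split=> //; apply: step_inj_phi_inj.
Qed.

Lemma triplet_exists (n : nat) (E : word -> word -> Prop) :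
  right_congruence E -> (Defs.classes E #= `I_n)%card ->
  exists T, tree_triplet n T /\ E = triplet_congruence T.
Proof.
move=> cE nE; have [P [trP cP distinct leafE]] := dfs_tree cE nE.
have /choice[g gP] : forall c, exists q,
    c \in leaves P -> [/\ q \in P, alpha_lt q c & E q c].
  move=> c; have [/leafE[q qP]|] := boolP (c \in leaves P); first by exists q.
  by exists c.
have [|T [eP eC gE]] := @triplet_mk P g; first by move=> c /gP[].
have trT : tree_triplet n T.
  by split; rewrite ?eP // => c cL; rewrite gE //; have [] := gP c cL.
exists T; split=> //; have [trP' eC' _ _] := trT.
have [[Er Es Et] Em] := cE.
have sub u v : triplet_congruence T u v -> E u v.
  apply=> // _ _ [c [-> ->]]; have cL : val c \in leaves P by rewrite -eC;
    apply: valP.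
  by rewrite -tf_wordE gE //; have [_ _ /Es] := gP _ cL.
apply/funext => u; apply/funext => v; apply/propext; split; last exact: sub.
(* Both relations reduce a word to its run, and nodes equivalent under [E] are equal, so [E] is no
   coarser. *)
have Erun w : E w (run T w).
  by apply/sub/triplet_congruenceE => //; rewrite [RHS]run_id // run_in.
move=> uv; apply/triplet_congruenceE => //.
apply: distinct; rewrite -?eP ?run_in //.
exact: (Et _ _ _ (Es _ _ (Erun u)) (Et _ _ _ uv (Erun v))).
Qed.

Lemma triplet_congruence_leaf (T : triplet) (c : word) :
  c \in tC T -> triplet_congruence T c (tf_word T c).
Proof.
by move=> cT E cE; apply; exists [` cT]%fset; rewrite (tf_wordE [` cT]%fset).
Qed.

Lemma triplet_node_inj (T : triplet) (p q : word) :
  tree (tP T) -> tC T = leaves (tP T) -> p \in tP T -> q \in tP T ->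
  triplet_congruence T p q -> p = q.
Proof. by move=> trP eC pP qP /triplet_congruenceE; rewrite !run_id //;
  apply. Qed.

(** At the first difference, a node [w] of one tree is a leaf of the other, congruent to a smaller
    node common to both: two nodes of one tree would be congruent. *)
Lemma triplet_unique (n : nat) (T T' : triplet) :
  tree_triplet n T -> tree_triplet n T' ->
  triplet_congruence T = triplet_congruence T' -> T = T'.
Proof.
have sub T1 T2 w : tree_triplet n T1 -> tree_triplet n T2 ->
    triplet_congruence T1 = triplet_congruence T2 ->
    (forall u, alpha_lt u w -> (u \in tP T1) = (u \in tP T2)) ->
    w \in tP T1 -> w \in tP T2.
  move=> [trP eC _ _] [trP' eC' _ lt'] eT agree wP; apply: contraT => wP'.
  have w0 : w != [::] by apply: contraNneq wP' => ->; exact: trP'.1.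
  have wL : w \in leaves (tP T2).
    by rewrite mem_leaves // wP' -agree ?par_lt // trP.2.
  have wC : w \in tC T2 by rewrite eC'.
  have := triplet_congruence_leaf wC;
    rewrite -eT => /(triplet_node_inj trP eC wP).
  rewrite agree ?lt' // tf_word_in // => /(_ isT) e.
  by have := lt' w wL; rewrite -e alpha_irr.
move=> trT trT' eT; have eP : tP T = tP T'.
  apply: lex_ext => w agree; apply/idP/idP; first exact: (sub T T').
  by apply: (sub T' T) => // u /agree.
have [trP eC _ _] := trT; have [_ eC' _ _] := trT'.
have eCC : tC T = tC T' by rewrite eC eC' eP.
apply: triplet_ext => // c cT; have cT' : c \in tC T' by rewrite -eCC.
apply: (triplet_node_inj trP eC); rewrite ?tf_word_in //.
  by rewrite eP tf_word_in.
apply/triplet_congruenceE => //.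
have /triplet_congruenceE <- // := triplet_congruence_leaf cT.
by apply/triplet_congruenceE => //; rewrite eT; apply: triplet_congruence_leaf.
Qed.

Lemma perm_word_unique (n : nat) (T : triplet) (s t : 'S_n.+1) :
  tree_triplet n T -> perm_word T s -> perm_word T t -> s = t.
Proof.
move=> [trP eC cP _] sT tT; apply/permP => i; apply: val_inj => /=.
have [|c cL e] := @rank_surj _ _ _ lexw (leaves (tP T)) i lexw_inj.
  by rewrite card_leaves // cP.
by have := sT c cL; rewrite -(tT c cL) /rank_leaf e inord_val.
Qed.

Lemma congruence_permP (n : nat) (T : triplet) (theta : 'S_n.+1) :
  0 < n -> tree_triplet n T ->
  congruence_perm (triplet_congruence T) theta <-> perm_word T theta.
Proof.
move=> n0 trT; have [trP eC cP _] := trT.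
split=> [[T' [/(valid_tripletP _ n0) trT' eT]]|pT].
  by rewrite -(triplet_unique trT trT' eT);
    apply: (triplet_permP _ trP eC cP).1.
exists T; split=> //; first exact/valid_tripletP.
exact/triplet_permP.
Qed.

Lemma regular_triplet (n : nat) (E : word -> word -> Prop) :
  regular_right_congruences n E ->
  exists T, [/\ tree_triplet n T, E = triplet_congruence T, closes_chains T
    & {in leaves (tP T) &, injective (phi_word T)}].
Proof.
move=> [cE rE nE]; have [T [trT eE]] := triplet_exists cE nE.
by exists T; move: rE; rewrite eE => /(triplet_regularP trT)[].
Qed.

Theorem theorem3 (n : nat) (hn : 1 <= n) :
  exists Theta : (word -> word -> Prop) -> 'S_n.+1,
    (forall E : word -> word -> Prop, regular_right_congruences n E ->
       forall theta : 'S_n.+1, congruence_perm E theta <-> theta = Theta E) /\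
    set_bij (regular_right_congruences n)
            [set s : 'S_n.+1 | indecomposable s] Theta.
Proof.
(* The identity is the default when no permutation is attached to [E]. *)
pose Theta E : 'S_n.+1 := xget 1%g [set theta | congruence_perm E theta].
have ThetaE T theta : tree_triplet n T -> perm_word T theta ->
    Theta (triplet_congruence T) = theta.
  move=> trT pT; apply: (perm_word_unique trT _ pT).
  apply/(congruence_permP _ hn trT).
  apply: (@xgetPex _ 1%g [set s | congruence_perm (triplet_congruence T) s]).
  by exists theta => /=; apply/(congruence_permP theta hn trT).
have ThetaP E : regular_right_congruences n E -> exists T,
    [/\ tree_triplet n T, E = triplet_congruence T,
      closes_chains T & perm_word T (Theta E)].
  move=> /regular_triplet[T [trT -> close inj]]; exists T; split=> //.
  have [trP eC cP _] := trT; have [theta pT] := perm_word_exists trP eC cP inj.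
  by rewrite (ThetaE T theta).
exists Theta; split=> [E /ThetaP[T [trT -> _ pT]] theta|].
  split=> [/(congruence_permP _ hn trT) /ThetaE ->//|->].
  exact/(congruence_permP _ hn trT).
split=> [E /ThetaP[T [trT _ close pT]]|E E'|theta ind].
- exact: (perm_word_indecomposable trT close pT).
- rewrite !inE => /ThetaP[T [trT eE close pT]] /ThetaP[T' [trT' eE' close'
  pT']] e.
  by rewrite eE eE' (perm_word_inj trT close pT trT' close') // e.
have [T [trT close inj pT]] := perm_word_surj hn ind.
exists (triplet_congruence T); last exact: ThetaE.
split; first exact: right_congruence_generated.
- exact/(triplet_regularP trT).
- by have [trP eC cP _] := trT; apply: triplet_classes.
Qed.
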